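(* Let $(\Omega,\mathcal F)$ be a measurable space, let $\mathcal P,\mathcal Q\subseteq\mathcal M_1$ be arbitrary nonempty sets of probability measures, and let $\xi:\mathcal Q\to\mathbb R$ be a bounded function. For $\nu\in\mathrm{ba}_+$ define the concave biconjugate $$\xi^{**}_{\mathcal Q}(\nu)=\inf_{f\in\mathcal B_b}\left(\int f\,d\nu-\inf_{\mathsf Q\in\mathcal Q}\bigl(\mathbb E_{\mathsf Q}[f]-\xi(\mathsf Q)\bigr)\right).$$ Then $$\sup_{X\in\mathcal E_b}\ \inf_{\mathsf Q\in\mathcal Q}\bigl(\mathbb E_{\mathsf Q}[\log X]-\xi(\mathsf Q)\bigr)\;=\;\min_{\nu\in\overline{\mathrm{co}}^*(\mathcal Q)}\ \min_{\mu\in\overline{\mathrm{co}}^*(\mathcal P)}\bigl(H(\nu\mid\mu)-\xi^{**}_{\mathcal Q}(\nu)\bigr),$$ even if one side, and then also the other side, equals infinity. Further, there exists a pair $(\mu^*,\nu^* )\in\overline{\mathrm{co}}^*(\mathcal P)\times\overline{\mathrm{co}}^*(\mathcal Q)$ that achieves the minimum on the right-hand side.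
   Context: $\mathcal M_1$ is the set of (countably additive) probability measures on $\mathcal F$. An e-variable for $\mathcal P$ is a measurable $X:\Omega\to[0,\infty]$ with $\int X\,d\mathsf P\le1$ for all $\mathsf P\in\mathcal P$; $\mathcal E_b$ is the set of e-variables that are bounded from above, $\sup_\omega X(\omega)<\infty$. Conventions: $\log0=-\infty$; $\mathbb E_{\mathsf Q}[\log X]=\mathbb E_{\mathsf Q}[(\log X)^+]-\mathbb E_{\mathsf Q}[(\log X)^-]$ if $\mathbb E_{\mathsf Q}[(\log X)^-]<\infty$, and $\mathbb E_{\mathsf Q}[\log X]=-\infty$ if $\mathbb E_{\mathsf Q}[(\log X)^-]=\infty$. $\mathcal B_b$ is the Banach space of bounded measurable functions $\Omega\to\mathbb R$ with the supremum norm. $\mathrm{ba}$ is the space of bounded finitely additive signed measures on $(\Omega,\mathcal F)$, $\mathrm{ba}_+$ its positive cone, and $\mathrm{ba}_1=\{\mu\in\mathrm{ba}_+:\mu(\Omega)=1\}$. For $\mathcal A\subseteq\mathrm{ba}$, $\overline{\mathrm{co}}^*(\mathcal A)$ is the closure of the convex hull of $\mathcal A$ in $\mathrm{ba}$ for the weak-$*$ topology $\sigma(\mathrm{ba},\mathcal B_b)$ (elements of $\mathcal B_b$ act on $\mathrm{ba}$ by finitely additive integration). Relative entropy: for $\nu\in\mathrm{ba}_1$, $\mu\in\mathrm{ba}_+$ and a finite measurable partition $\pi=\{A_1,\dots,A_n\}$ of $\Omega$, $H_\pi(\nu\mid\mu)=\sum_{i=1}^n\nu(A_i)\log\frac{\nu(A_i)}{\mu(A_i)}$,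 where $q\log(q/p)=0$ if $q=0$ and $=\infty$ if $p=0<q$; $H(\nu\mid\mu)=\sup_\pi H_\pi(\nu\mid\mu)$ over all finite measurable partitions. *)

(* Defs.v *)
From HB Require Import structures.
From mathcomp Require Import all_boot all_order all_algebra.
From mathcomp Require Import all_classical all_reals all_analysis.
From mathcomp Require Import measurable_realfun.

Set Implicit Arguments.
Unset Strict Implicit.
Unset Printing Implicit Defensive.

Import Order.TTheory GRing.Theory Num.Theory.
Import numFieldNormedType.Exports HBSimple.

Local Open Scope classical_set_scope.
Local Open Scope ring_scope.

Section bounded_measurable.
Context {d : measure_display} (T : measurableType d) (R : realType).

Definition Bb : set (T -> R) :=
  [set f : T -> R | measurable_fun setT f
                    /\ exists M : R, forall x, `|f x| <= M].

End bounded_measurable.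
Arguments Bb {d} T R.

Section ba_space.
Context {d : measure_display} (T : measurableType d) (R : realType).

(* A set function on the sigma-algebra is represented by its extension by 0 to
   all subsets of T, so that Leibniz equality (hence the vector space structure
   below) is that of set functions on the sigma-algebra. *)
Definition is_ba (mu : set T -> R) : Prop :=
  [/\ forall A, ~ measurable A -> mu A = 0,
      forall A B, measurable A -> measurable B -> A `&` B = set0 ->
        mu (A `|` B) = mu A + mu B
    & exists M : R, forall A, measurable A -> `|mu A| <= M].

Definition ba_pred : {pred set T -> R} := fun mu => `[< is_ba mu >].

Lemma ba_submod_closed : submod_closed ba_pred.
Proof.
split=> [|c mu nu /asboolP[mu0 muD [M muM]] /asboolP[nu0 nuD [N nuN]]].
  apply/asboolP; split=> // [A B _ _ _|]; first by rewrite /= addr0.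
  by exists 0 => A _; rewrite normr0.
have E A : (c *: mu + nu) A = c * mu A + nu A by [].
apply/asboolP; split=> [A mA|A B mA mB AB|].
- by rewrite E mu0// nu0// mulr0 addr0.
- by rewrite !E muD// nuD// mulrDr addrACA.
- exists (`|c| * M + N) => A mA; rewrite E (le_trans (ler_normD _ _))//.
  by rewrite lerD ?nuN// normrM ler_wpM2l// muM.
Qed.

HB.instance Definition _ :=
  GRing.isSubmodClosed.Build R (set T -> R) ba_pred ba_submod_closed.

Record ba := Ba { ba_val :> set T -> R; ba_valP : ba_val \in ba_pred }.

HB.instance Definition _ := [isSub for ba_val].
HB.instance Definition _ := [Choice of ba by <:].
HB.instance Definition _ := [SubChoice_isSubZmodule of ba by <:].
HB.instance Definition _ := [SubZmodule_isSubLmodule of ba by <:].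

Definition ba_sintegral (mu : ba) (s : T -> R) : R :=
  \sum_(y \in range s) y * mu (s @^-1` [set y]).

Definition sfun_unif_nbhs (f : T -> R) : set_system {sfun T >-> R} :=
  filter_from [set e : R | 0 < e]
    (fun e => [set s : {sfun T >-> R} | forall x, `|f x - s x| < e]).

(* Finitely additive integral: the limit of the integrals of simple functions
   that converge uniformly to f. *)
Definition ba_integral (mu : ba) (f : T -> R) : R :=
  lim ((fun s : {sfun T >-> R} => ba_sintegral mu s) @ sfun_unif_nbhs f).

(* The weak-* topology sigma(ba, Bb): the initial topology of the evaluations
   at the elements of Bb. *)
Definition ba_eval (mu : ba) : {ptws (Bb T R) -> R} :=
  fun f => ba_integral mu (\val f).

HB.instance Definition _ := Topological.copy ba (initial_topology ba_eval).

Definition closed_convex_hull (A : set ba) : set ba :=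
  closure (smallest (@convex_set R ba) A).

(* Off the sigma-algebra, the underlying function of P is arbitrary. *)
Definition set_fun_of_probability (P : probability T R) (A : set T) : R :=
  if `[< measurable A >] then fine (P A) else 0.

Lemma set_fun_of_probabilityP (P : probability T R) :
  set_fun_of_probability P \in ba_pred.
Proof.
have fP A : measurable A -> P A \is a fin_num by exact: fin_num_measure.
apply/asboolP; rewrite /set_fun_of_probability.
split=> [A nmA|A B mA mB AB|]; first by rewrite asboolF.
- by rewrite !asboolT ?measureU ?fineD ?fP//; exact: measurableU.
- exists 1 => A mA; rewrite asboolT// ger0_norm ?fine_ge0//.
  by rewrite -lee_fin fineK ?fP// probability_le1.
Qed.

Definition ba_of_probability (P : probability T R) : ba :=
  Ba (set_fun_of_probabilityP P).

End ba_space.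

Section e_variables.
Context {d : measure_display} {T : measurableType d} {R : realType}.
Local Open Scope ereal_scope.

Definition evariable (P : set (probability T R)) : set (T -> \bar R) :=
  [set X : T -> \bar R | [/\ measurable_fun setT X, forall x, 0 <= X x
             & forall p, P p -> \int[p]_x X x <= 1]].

Definition bounded_evariable (P : set (probability T R)) : set (T -> \bar R) :=
  [set X : T -> \bar R | evariable P X /\ exists M : R, forall x, X x <= M%:E].

(* lne 0 = -oo *)
Definition expectation_log (q : probability T R) (X : T -> \bar R) : \bar R :=
  let L x := lne (X x) in
  if \int[q]_x L^\- x < +oo then \int[q]_x L^\+ x - \int[q]_x L^\- x
  else -oo.

End e_variables.

Section relative_entropy.
Context {d : measure_display} {T : measurableType d} {R : realType}.
Local Open Scope ereal_scope.

Definition entropy_term (q p : R) : \bar R :=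
  if q == 0%R then 0
  else if p == 0%R then +oo
  else (q * ln (q / p))%:E.

Definition partition_entropy (nu mu : ba T R) n (A : 'I_n -> set T) : \bar R :=
  \sum_(i < n) entropy_term (nu (A i)) (mu (A i)).

Definition relative_entropy (nu mu : ba T R) : \bar R :=
  ereal_sup [set h | exists n (A : 'I_n -> set T),
    [/\ forall i, measurable (A i), classical_sets.partition setT A setT
      & h = partition_entropy nu mu A]].

End relative_entropy.

Section optimization.
Context {d : measure_display} {T : measurableType d} {R : realType}.
Local Open Scope ereal_scope.

Definition concave_biconjugate (Q : set (probability T R))
    (xi : probability T R -> R) (nu : ba T R) : \bar R :=
  ereal_inf [set (ba_integral nu f)%:E
                 - ereal_inf [set 'E_q[f] - (xi q)%:E | q in Q] | f in Bb T R].

Definition attains_min (X : Type) (A : set X) (F : X -> \bar R) : Prop :=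
  exists2 x, A x & F x = ereal_inf (F @` A).

End optimization.

(* Main.v *)
Require Import Defs.
From HB Require Import structures.
From mathcomp Require Import all_boot all_order all_algebra finmap.
From mathcomp Require Import all_classical all_reals all_analysis.
From mathcomp Require Import measurable_realfun.
From mathcomp Require Import ring lra.
Import Order.TTheory GRing.Theory Num.Theory.
Import numFieldNormedType.Exports HBSimple.
Local Open Scope classical_set_scope.
Local Open Scope ring_scope.

(** The right-hand side is a supremum of affine functions.  By the variational
    formula [H(nu | mu) = sup_f (1 + \int f dnu - \int e^f dmu)], valid for
    finitely additive probabilities, and by the definition of the biconjugate,
    [H(nu | mu) - xi**(nu)] is the supremum over pairs [(f, h)] of bounded
    measurable functions of
      [payoff (f, h) (nu, mu) =
         1 + \int f dnu - \int e^f dmu - (\int h dnu - g h)],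
    where [g h = inf_Q (E_Q h - xi Q)] is [worst_case h] ([objective_leP]).  The
    payoff is affine and weak-* continuous in [(nu, mu)] and concave in [(f, h)].

    The finitely additive probabilities form a weak-* compact set
    ([ba1_compact]), so the two closed convex hulls are compact, the objective is
    lower semicontinuous on them, and all the minima are attained
    ([attains_min_compact]).

    For the inequality [<=], an e-variable [X] bounded above gives the payoff of
    [f = h = ln (X + e)], which is at least [g f - e] because
    [\int (X + e) dmu <= 1 + e] on the hull of P; letting [e] tend to 0 yields
    [weak_duality].

    For the inequality [>=], let [c] exceed the left-hand side.  If finitely many
    pairs [(f_i, h_i)] had no point of [co Q x co P] where every payoff is at
    most [c], then by a finite minimax theorem ([finite_minimax]) a single pair
    [(f, h)] would have payoff at least [c] on all of [co Q x co P].  Evaluating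
    at pairs in [Q x P], using [g h <= E_Q h - xi Q] and [1 - S <= - ln S] with
    [S = sup_P E_P e^f], the e-variable [e^f / S] would then have value at least
    [c], a contradiction ([payoff_le_value]).  Compactness turns the finite
    statement into a point [(nu, mu)] at which all payoffs are at most [c]
    ([minimax_point]). *)

(** * Finite measurable colourings *)

Section finite_colouring.
Context {d : measure_display} {T : measurableType d} {R : realType}.
Implicit Types (mu nu : ba T R) (f g : T -> R).

(** A finite measurable partition is encoded by the map to the index of the cell:
    disjointness and covering are then automatic, empty cells are harmless, and
    the common refinement of two partitions is the pairing of the two maps. *)
Definition mcolouring {I : finType} (c : T -> I) : Prop :=
  forall i, measurable (c @^-1` [set i]).

Lemma mcolouring_pair {I J : finType} (c : T -> I) (e : T -> J) :
  mcolouring c -> mcolouring e -> mcolouring (fun x => (c x, e x)).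
Proof.
move=> mc me [i j].
rewrite (_ : _ @^-1` _ = (c @^-1` [set i]) `&` (e @^-1` [set j])).
  exact: measurableI.
by apply/seteqP; split => x /= => [[-> ->]|[-> ->]].
Qed.

Lemma mcolouring_preimage {I : finType} (c : T -> I) (D : set I) :
  mcolouring c -> measurable (c @^-1` D).
Proof.
move=> mc; rewrite (_ : _ @^-1` _ = \bigcup_(i in D) (c @^-1` [set i])).
  by apply: fin_bigcup_measurable => //; exact: finite_finset.
by apply/seteqP; split => [x Dx|x [i Di] /= cxi]; [exists (c x)|rewrite /= cxi].
Qed.

Lemma mcolouring_comp {I : finType} (c : T -> I) (a : I -> R) :
  mcolouring c -> Bb T R (fun x => a (c x)).
Proof.
move=> mc; split.
  by move=> _ Y mY; rewrite setTI; exact: (mcolouring_preimage _ (a @^-1` Y)).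
exists (\sum_i `|a i|) => x; rewrite (bigD1 (c x))//= lerDl.
by apply: sumr_ge0.
Qed.

Lemma ba_set0 mu : mu set0 = 0.
Proof.
have /asboolP[_ muD _] := ba_valP mu.
have := muD set0 set0 measurable0 measurable0 (setI0 _).
by rewrite setU0 => /eqP; rewrite -subr_eq0 opprD addNKr oppr_eq0 => /eqP.
Qed.

Lemma ba_colouring mu {I : finType} (c : T -> I) (P : pred I) : mcolouring c ->
  mu (c @^-1` [set i | P i]) = \sum_(i | P i) mu (c @^-1` [set i]).
Proof.
move=> mc; have /asboolP[_ muD _] := ba_valP mu.
rewrite -big_filter.
rewrite -[in LHS](_ : [set i | i \in [seq i <- index_enum I | P i]] = [set i | P i]);
  last first.
  by apply/seteqP; split=> i /=; rewrite mem_filter mem_index_enum andbT.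
have: uniq [seq i <- index_enum I | P i] by rewrite filter_uniq// index_enum_uniq.
elim: [seq i <- index_enum I | P i] => [_|i r ih /= /andP[ir ur]].
  by rewrite big_nil -(ba_set0 mu); congr (mu _); apply/seteqP; split.
rewrite big_cons -ih// -muD; [|exact: mc|exact: mcolouring_preimage|].
- congr (mu _); apply/seteqP; split=> x /=; rewrite inE.
    by move=> /orP[/eqP->|]; [left|right].
  by case=> ->; rewrite ?eqxx ?orbT.
- by apply/seteqP; split=> x //= [->] ri; rewrite ri in ir.
Qed.

Lemma ba_sum_colouring mu {I : finType} (c : T -> I) : mcolouring c ->
  \sum_i mu (c @^-1` [set i]) = mu setT.
Proof.
by move=> mc; rewrite -(ba_colouring _ _ predT)//; congr (mu _); apply/seteqP; split.
Qed.

Definition variation_le mu (C : R) := forall (I : finType) (c : T -> I),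
  mcolouring c -> \sum_i `|mu (c @^-1` [set i])| <= C.

(** The cells of positive and of negative mass have unions in the sigma-algebra,
    whose masses are bounded by the bound [M] of the charge; hence [C = 2 M]. *)
Lemma ba_variation mu : exists2 C : R, 0 <= C & variation_le mu C.
Proof.
have /asboolP[_ _ [M muM]] := ba_valP mu.
have M0 : 0 <= M by rewrite (le_trans _ (muM _ measurable0)).
exists (M + M) => [|I c mc]; first by rewrite addr_ge0.
rewrite (bigID (fun i => 0 <= mu (c @^-1` [set i])))/=; apply: lerD.
  rewrite (eq_bigr (fun i => mu (c @^-1` [set i]))) => [|i ?]; last first.
    by rewrite ger0_norm.
  rewrite -ba_colouring// (le_trans (ler_norm _))//.
  by apply: muM; exact: mcolouring_preimage.
rewrite (eq_bigr (fun i => - mu (c @^-1` [set i]))) => [|i]; last first.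
  by rewrite -ltNge => ?; rewrite ltr0_norm.
rewrite sumrN -ba_colouring// (le_trans (ler_norm _))// normrN.
by apply: muM; exact: mcolouring_preimage.
Qed.

Lemma ba_sintegral_colouring mu {I : finType} (c : T -> I) (a : I -> R) :
  mcolouring c ->
  ba_sintegral mu (fun x => a (c x)) = \sum_i a i * mu (c @^-1` [set i]).
Proof.
move=> mc; rewrite /ba_sintegral.
have E y : mu ((fun x => a (c x)) @^-1` [set y]) =
    \sum_(i | a i == y) mu (c @^-1` [set i]).
  by rewrite -ba_colouring//; congr (mu _); apply/seteqP; split=> x /= => [->//|/eqP].
pose r := undup [seq a i | i : I].
have ur : uniq r by exact: undup_uniq.
have rr i : a i \in r by rewrite mem_undup map_f ?mem_enum.
rewrite (fsbig_fwiden r)//; first last.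
- move=> y [/= _ yr]; rewrite E big1 ?mulr0// => i /eqP aiy.
  have [[x cx]|c0] := pselect (exists x, c x = i).
    by case: yr; exists x => //=; rewrite cx.
  by rewrite -(ba_set0 mu); congr (mu _); apply/seteqP; split=> x // cx; case: c0; exists x.
- by move=> _ [x _ <-]; exact: rr.
under eq_bigr do rewrite E mulr_sumr.
rewrite (exchange_big_dep predT)//=; apply: eq_bigr => i _.
rewrite -big_filter (_ : [seq _ <- _ | _] = [:: a i]) ?big_seq1//.
rewrite (eq_filter (a2 := pred1 (a i))) ?filter_pred1_uniq// => y /=.
by rewrite eq_sym.
Qed.

End finite_colouring.

(** * Integration against finitely additive measures *)

Section integral.
Context {d : measure_display} {T : measurableType d} {R : realType}.
Implicit Types (mu nu : ba T R) (f g : T -> R).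

Lemma sfun_colouring (s : {sfun T >-> R}) :
  exists (I : finType) (c : T -> I) (a : I -> R),
    mcolouring c /\ forall x, s x = a (c x).
Proof.
have sr x : s x \in fset_set (range s) by rewrite in_fset_set ?inE//; exact: fimfunP.
pose c x : fset_set (range s) := [` sr x]%fset.
exists (fset_set (range s)), c, val; split=> [i|//].
rewrite (_ : _ @^-1` _ = s @^-1` [set val i]); first exact: measurable_sfunP.
by apply/seteqP; split=> x /= => [<-//|?]; exact: val_inj.
Qed.

Lemma colouring_sfun {I : finType} (c : T -> I) (a : I -> R) : mcolouring c ->
  exists s : {sfun T >-> R}, forall x, s x = a (c x).
Proof.
move=> mc; have [mf _] := mcolouring_comp _ a mc.
have ff : finite_set (range (fun x => a (c x))).
  apply: (@sub_finite_set _ _ (a @` setT)) => [_ [x _ <-]|]; first by exists (c x).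
  by apply: finite_image; exact: finite_finset.
pose h : {sfun T >-> R} := HB.pack (fun x => a (c x))
  (isMeasurableFun.Build _ _ _ _ _ mf) (FiniteImage.Build _ _ _ ff).
by exists h.
Qed.

(** The cells are the level sets of [floor ((f + M) / e)], where [M] bounds
    [|f|]. *)
Lemma Bb_colouring_approx f (e : R) : Bb T R f -> 0 < e ->
  exists (I : finType) (c : T -> I) (a : I -> R),
    mcolouring c /\ forall x, `|f x - a (c x)| < e.
Proof.
move=> [mf [M fM]] e0.
pose u x := (f x + M) / e.
have u0 x : 0 <= u x.
  rewrite divr_ge0 ?(ltW e0)//; have := fM x; rewrite ler_norml => /andP[+ _]; lra.
pose N := Num.truncn ((M + M) / e).
have uN x : (Num.truncn (u x) < N.+1)%N.
  rewrite ltnS; apply: le_truncn; rewrite ler_pdivrMr// divfK ?gt_eqF//.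
  by have := fM x; rewrite ler_norml => /andP[_]; rewrite lerD2r.
pose c x : 'I_N.+1 := Ordinal (uN x).
exists 'I_N.+1, c, (fun i : 'I_N.+1 => - M + i%:R * e); split=> [i|x].
  rewrite (_ : _ @^-1` _ = setT `&` f @^-1` `[- M + i%:R * e, - M + i.+1%:R * e[).
    by apply: mf => //; exact: measurable_itv.
  have H x : (f x \in `[- M + i%:R * e, - M + i.+1%:R * e[) = (i%:R <= u x < i.+1%:R).
    by rewrite in_itv/= ler_pdivlMr// ltr_pdivrMr//; congr (_ && _); apply/idP/idP => ?; lra.
  rewrite setTI; apply/seteqP; split=> x /=; rewrite H.
    by move=> <- /=; exact: truncn_itv.
  by move=> /truncn_def ci; apply/val_inj.
have /andP[] := truncn_itv (u0 x); rewrite /= ler_pdivlMr// ltr_pdivrMr//.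
rewrite -natr1 mulrDl mul1r => ? ?; rewrite ger0_norm; lra.
Qed.

(** Both sums are rewritten on the common refinement, where the coefficients
    differ by at most [e] on every nonempty cell. *)
Lemma ba_colouring_dist mu (C e : R) {I J : finType} (c : T -> I) (b : T -> J)
    (a : I -> R) (a' : J -> R) :
  variation_le mu C ->
  mcolouring c -> mcolouring b -> 0 <= e -> (forall x, `|a (c x) - a' (b x)| <= e) ->
  `|\sum_i a i * mu (c @^-1` [set i]) - \sum_j a' j * mu (b @^-1` [set j])| <= e * C.
Proof.
move=> muC mc mb e0 ab.
have mcb := mcolouring_pair _ _ mc mb.
rewrite -!ba_sintegral_colouring//.
rewrite (ba_sintegral_colouring _ _ (fun ij => a ij.1) mcb).
rewrite (ba_sintegral_colouring _ _ (fun ij => a' ij.2) mcb).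
rewrite -sumrB (le_trans (ler_norm_sum _ _ _))//.
rewrite (le_trans _ (ler_wpM2l e0 (muC _ _ mcb)))// mulr_sumr; apply: ler_sum => -[i j] _.
rewrite -mulrBl normrM.
have [[x /= [<- <-]]|n0] := pselect (exists x, (c x, b x) = (i, j)).
  by rewrite ler_wpM2r.
rewrite (_ : _ @^-1` _ = set0) ?ba_set0 ?normr0 ?mulr0//.
by apply/seteqP; split=> // x cbx; case: n0; exists x.
Qed.

Lemma sfun_unif_nbhs_proper f : Bb T R f -> ProperFilter (sfun_unif_nbhs f).
Proof.
move=> bf; apply: filter_from_proper.
  apply: filter_from_filter; first by exists 1; exact: ltr01.
  move=> e1 e2 /= e10 e20; exists (Num.min e1 e2); first by rewrite /= lt_min e10.
  by move=> s /= H; split=> x; move: (H x); rewrite lt_min => /andP[].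
move=> e /= e0; have [I [c [a [mc fa]]]] := Bb_colouring_approx _ _ bf e0.
by have [s sa] := colouring_sfun _ a mc; exists s => x; rewrite /= sa.
Qed.

(** The error bound that replaces the limit over simple functions by Riemann
    sums; every property of the integral below is derived from it. *)
Lemma ba_integral_approx mu f (C e : R) {I : finType} (c : T -> I) (a : I -> R) :
  variation_le mu C ->
  Bb T R f -> mcolouring c -> 0 <= e -> (forall x, `|f x - a (c x)| <= e) ->
  `|ba_integral mu f - \sum_i a i * mu (c @^-1` [set i])| <= e * C.
Proof.
move=> muC bf mc e0 fa; rewrite /ba_integral.
have PF := sfun_unif_nbhs_proper _ bf.
have C0 : 0 <= C by apply: le_trans (muC _ _ mc); exact: sumr_ge0.
have key (e1 e2 : R) (s t : {sfun T >-> R}) : 0 <= e1 -> 0 <= e2 ->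
    (forall x, `|f x - s x| <= e1) -> (forall x, `|f x - t x| <= e2) ->
    `|ba_sintegral mu s - ba_sintegral mu t| <= (e1 + e2) * C.
  move=> e10 e20 fs ft.
  have [Is [cs [a_s [mcs ss]]]] := sfun_colouring s.
  have [It [ct [a_t [mct tt]]]] := sfun_colouring t.
  rewrite (_ : HBSimple.SimpleFun.sort s = fun x => a_s (cs x)); last exact/funext.
  rewrite (_ : HBSimple.SimpleFun.sort t = fun x => a_t (ct x)); last exact/funext.
  rewrite !ba_sintegral_colouring//; apply: ba_colouring_dist => //; first exact: addr_ge0.
  move=> x; rewrite -ss -tt -[s x - _](_ : (s x - f x) + (f x - t x) = _); last by ring.
  by rewrite (le_trans (ler_normD _ _))// lerD// distrC.
set S := (X in X @ _).
(* Simple functions e'-close to f have integrals within 2 e' C < e1, so the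
   integrals form a Cauchy filter; the + 2 in e' covers the case C = 0. *)
have cS : cvg (S @ sfun_unif_nbhs f).
  apply/cauchy_cvgP/cauchy_exP => e1 e10.
  pose e' := e1 / (2 * C + 2).
  have e'0 : 0 < e' by rewrite divr_gt0//; lra.
  have [J [b [a' [mb fb]]]] := Bb_colouring_approx _ _ bf e'0.
  have [s sa'] := colouring_sfun _ a' mb.
  exists (S s); exists e' => // t /= ft.
  rewrite /ball/= (le_lt_trans (key e' e' _ _ _ _ _ _))// ?ltW//.
  - by move=> x; rewrite sa' ltW.
  - by move=> x; rewrite ltW.
  - rewrite /e' -mulrDl mulrAC ltr_pdivrMr; nra.
have [s sa] := colouring_sfun _ a mc.
have -> : \sum_i a i * mu (c @^-1` [set i]) = S s.
  rewrite -(ba_sintegral_colouring mu c a mc); congr ba_sintegral.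
  by apply/funext => x; rewrite sa.
apply/ler_addgt0Pr => r r0.
pose e1 := r / (2 * C + 2).
have e10 : 0 < e1 by rewrite divr_gt0//; lra.
have : \forall t \near sfun_unif_nbhs f, `|lim (S @ sfun_unif_nbhs f) - S t| < e1.
  by move/cvgrPdist_lt : cS; exact.
have : sfun_unif_nbhs f [set t : {sfun T >-> R} | forall x, `|f x - t x| < e1] by exists e1.
move=> /filterI /[apply] /filter_ex[t /= [ft lt]].
rewrite -[X in `|X|](_ : (lim (S @ sfun_unif_nbhs f) - S t) + (S t - S s) = _); last by ring.
rewrite (le_trans (ler_normD _ _))//.
have := key e1 e t s (ltW e10) e0 (fun x => ltW (ft x)).
rewrite -/(S t) -/(S s) => /(_ _)/le_trans H.
have -> : e * C + r = e1 + (e1 + e) * C + (r - e1 * (1 + C)) by ring.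
rewrite -[leLHS]addr0 lerD//; last first.
  rewrite subr_ge0 /e1 mulrAC ler_pdivrMr; nra.
rewrite lerD ?(ltW lt)//; apply: H => //.
by move=> x; rewrite sa.
Qed.

End integral.

Section integral_theory.
Context {d : measure_display} {T : measurableType d} {R : realType}.
Implicit Types (mu nu : ba T R) (f g : T -> R).

(** A number with the same error estimate as the integral, up to a constant, is
    the integral. *)
Lemma ba_integral_eq mu f (L K : R) : Bb T R f ->
  (forall (I : finType) (c : T -> I) (a : I -> R) (e : R), mcolouring c -> 0 < e ->
    (forall x, `|f x - a (c x)| <= e) ->
    `|L - \sum_i a i * mu (c @^-1` [set i])| <= e * K) ->
  ba_integral mu f = L.
Proof.
move=> bf H; have [C C0 muC] := ba_variation mu.
apply/eqP; rewrite -subr_eq0 -normr_le0; apply/ler_addgt0Pr => r r0.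
have [I [c [a [mc _]]]] := Bb_colouring_approx _ _ bf ltr01.
have K0 : 0 <= C + `|K| by rewrite addr_ge0.
pose e := r / (C + `|K| + 1).
have e0 : 0 < e by rewrite divr_gt0//; lra.
have [{I c a mc}I [c [a [mc /(_ _)/ltW fa]]]] := Bb_colouring_approx _ _ bf e0.
have h1 := ba_integral_approx _ _ _ _ _ _ muC bf mc (ltW e0) fa.
have h2 := H _ _ _ _ mc e0 fa.
set S := \sum_i _ in h1 h2.
have -> : ba_integral mu f - L = (ba_integral mu f - S) - (L - S) by ring.
rewrite (le_trans (ler_normB _ _))// add0r.
have -> : r = e * (C + `|K| + 1) by rewrite divfK// gt_eqF//; lra.
have := ler_norm K; nra.
Qed.

Lemma ba_integral_colouring mu {I : finType} (c : T -> I) (a : I -> R) :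
  mcolouring c -> ba_integral mu (fun x => a (c x)) = \sum_i a i * mu (c @^-1` [set i]).
Proof.
move=> mc; have [C C0 muC] := ba_variation mu.
have := ba_integral_approx _ _ _ _ _ a muC (mcolouring_comp _ a mc) mc (lexx 0) _.
rewrite mul0r normr_le0 subr_eq0 => /(_ _)/eqP; apply => x.
by rewrite subrr normr0.
Qed.

Lemma Bb_cst (k : R) : Bb T R (fun=> k).
Proof. by split; [exact: measurable_cst|exists `|k|]. Qed.

Lemma Bb_indic A : measurable A -> Bb T R (\1_A).
Proof.
move=> mA; split; first exact: measurable_indic.
by exists 1 => x; rewrite indicE; case: (_ \in _); rewrite ?normr1 ?normr0.
Qed.

Lemma Bb_lin (k : R) f g : Bb T R f -> Bb T R g -> Bb T R (fun x => k * f x + g x).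
Proof.
move=> [mf [M fM]] [mg [N gN]]; split.
  by apply: measurable_funD => //; exact: measurable_funM.
exists (`|k| * M + N) => x; rewrite (le_trans (ler_normD _ _))// lerD// normrM.
by rewrite ler_wpM2l.
Qed.

Lemma BbD f g : Bb T R f -> Bb T R g -> Bb T R (fun x => f x + g x).
Proof. by move=> /(Bb_lin 1) H /H{H}; under eq_fun do rewrite mul1r. Qed.

Lemma BbB f g : Bb T R f -> Bb T R g -> Bb T R (fun x => f x - g x).
Proof.
by move=> + /(Bb_lin (-1)) H => /H; under eq_fun do rewrite mulN1r addrC.
Qed.

Lemma Bb_expR f : Bb T R f -> Bb T R (fun x => expR (f x)).
Proof.
move=> [mf [M fM]]; split; first exact: measurableT_comp.
exists (expR M) => x; rewrite ger0_norm ?expR_ge0// ler_expR.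
by have := fM x; rewrite ler_norml => /andP[].
Qed.

Lemma ba_integral_lin mu (k : R) f g : Bb T R f -> Bb T R g ->
  ba_integral mu (fun x => k * f x + g x) = k * ba_integral mu f + ba_integral mu g.
Proof.
move=> bf bg; have [C C0 muC] := ba_variation mu.
apply: (@ba_integral_eq _ _ _ ((2 + `|k| + `|k|) * C + C)); first exact: Bb_lin.
move=> I c a e mc e0 fa.
have [J [b [f' [mb /(_ _)/ltW ff']]]] := Bb_colouring_approx _ _ bf e0.
have [J' [b' [g' [mb' /(_ _)/ltW gg']]]] := Bb_colouring_approx _ _ bg e0.
have mbb := mcolouring_pair _ _ mb mb'.
have h1 := ba_integral_approx _ _ _ _ _ (fun ij => f' ij.1) muC bf mbb (ltW e0) ff'.
have h2 := ba_integral_approx _ _ _ _ _ (fun ij => g' ij.2) muC bg mbb (ltW e0) gg'.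
have e1 : 0 <= e * (2 + `|k|) by rewrite mulr_ge0 ?(ltW e0)// addr_ge0.
have := ba_colouring_dist mu C _ _ _ (fun ij => k * f' ij.1 + g' ij.2) a muC mbb mc e1 _.
move=> /(_ _)/= h3.
set S1 := \sum_i f' _ * _ in h1; set S2 := \sum_i g' _ * _ in h2.
set S := \sum_i a _ * _ in h3 *.
have {}h3 : `|k * S1 + S2 - S| <= e * (2 + `|k|) * C.
  rewrite mulr_sumr -big_split/=; under eq_bigr do rewrite mulrA -mulrDl.
  apply: h3 => x; move: (ff' x) (gg' x) (fa x) => {h1 h2}H1 H2 H3.
  rewrite [X in `|X|](_ : _ = (k * f x + g x - a (c x)) - (k * (f x - f' (b x))) -
    (g x - g' (b' x))); last by ring.
  rewrite (le_trans (ler_normB _ _))// (_ : _ * (2 + _) = (e + `|k| * e) + e); last by ring.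
  rewrite lerD// (le_trans (ler_normB _ _))// lerD// normrM ler_wpM2l//.
rewrite [X in `|X|](_ : _ = (k * (ba_integral mu f - S1) + (ba_integral mu g - S2)) +
  (k * S1 + S2 - S)); last by ring.
rewrite (le_trans (ler_normD _ _))//.
have h4 : `|k * (ba_integral mu f - S1)| <= `|k| * (e * C) by rewrite normrM ler_wpM2l.
have := ler_normD (k * (ba_integral mu f - S1)) (ba_integral mu g - S2); lra.
Qed.

Lemma Bb_comb t f g : Bb T R f -> Bb T R g -> Bb T R (fun x => t * f x + (1 - t) * g x).
Proof.
move=> bf bg; apply: Bb_lin => //.
by under eq_fun do rewrite -[_ * _]addr0; apply: Bb_lin => //; exact: Bb_cst.
Qed.

Lemma ba_integral_cst mu (k : R) : ba_integral mu (fun=> k) = k * mu setT.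
Proof.
have mc : @mcolouring d T unit (fun=> tt).
  by move=> []; rewrite (_ : _ @^-1` _ = setT)//; apply/seteqP; split.
rewrite -(ba_sum_colouring mu _ mc) mulr_sumr.
exact: (ba_integral_colouring mu (fun=> tt) (fun=> k)).
Qed.

Lemma ba_integralD mu f g : Bb T R f -> Bb T R g ->
  ba_integral mu (fun x => f x + g x) = ba_integral mu f + ba_integral mu g.
Proof.
move=> bf bg; have := ba_integral_lin mu 1 _ _ bf bg; rewrite mul1r => <-.
by under [in RHS]eq_fun do rewrite mul1r.
Qed.

Lemma ba_integralB mu f g : Bb T R f -> Bb T R g ->
  ba_integral mu (fun x => f x - g x) = ba_integral mu f - ba_integral mu g.
Proof.
move=> bf bg; have := ba_integral_lin mu (-1) _ _ bg bf; rewrite mulN1r addrC => <-.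
by under [in RHS]eq_fun do rewrite mulN1r addrC.
Qed.

Lemma ba_integral_combr mu t f g : Bb T R f -> Bb T R g ->
  ba_integral mu (fun x => t * f x + (1 - t) * g x) =
  t * ba_integral mu f + (1 - t) * ba_integral mu g.
Proof.
move=> bf bg.
have bg' : Bb T R (fun x => (1 - t) * g x + 0) by exact: Bb_lin _ (Bb_cst 0).
have E : (fun x => t * f x + (1 - t) * g x) = (fun x => t * f x + ((1 - t) * g x + 0)).
  by apply/funext => x; rewrite addr0.
by rewrite E !ba_integral_lin ?ba_integral_cst ?mul0r ?addr0//; exact: Bb_cst.
Qed.

Lemma ba_integral_comb (t : R) mu nu f : Bb T R f ->
  ba_integral (t *: mu + (1 - t) *: nu) f = t * ba_integral mu f + (1 - t) * ba_integral nu f.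
Proof.
move=> bf; have [C C0 muC] := ba_variation mu; have [D D0 nuD] := ba_variation nu.
apply: (@ba_integral_eq _ _ _ (`|t| * C + `|1 - t| * D)) => // I c a e mc e0 fa.
have h1 := ba_integral_approx _ _ _ _ _ _ muC bf mc (ltW e0) fa.
have h2 := ba_integral_approx _ _ _ _ _ _ nuD bf mc (ltW e0) fa.
have -> : \sum_i a i * (t *: mu + (1 - t) *: nu : ba T R) (c @^-1` [set i]) =
    t * (\sum_i a i * mu (c @^-1` [set i])) + (1 - t) * (\sum_i a i * nu (c @^-1` [set i])).
  rewrite !mulr_sumr -big_split/=; apply: eq_bigr => i _.
  rewrite (_ : (_ + _) _ = t * mu (c @^-1` [set i]) + (1 - t) * nu (c @^-1` [set i]))//.
  by ring.
rewrite opprD addrACA -!mulrBr (le_trans (ler_normD _ _))// !normrM mulrDr lerD//.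
  by rewrite mulrCA ler_wpM2l.
by rewrite mulrCA ler_wpM2l.
Qed.

Definition ba1 : set (ba T R) :=
  [set mu | (forall A, measurable A -> 0 <= mu A) /\ mu setT = 1].

Lemma ba1_variation mu : ba1 mu -> variation_le mu 1.
Proof.
move=> [mu0 mu1] I c mc; rewrite -mu1 -(ba_sum_colouring mu _ mc).
by rewrite ler_sum// => i _; rewrite ger0_norm ?mu0.
Qed.

Lemma ba_integral_ge0 mu f : ba1 mu -> Bb T R f -> (forall x, 0 <= f x) ->
  0 <= ba_integral mu f.
Proof.
move=> mu1 bf f0; apply/ler_addgt0Pr => e e0.
have e20 : 0 < e / 2 by rewrite divr_gt0.
have [I [c [a [mc /(_ _)/ltW fa]]]] := Bb_colouring_approx _ _ bf e20.
have := ba_integral_approx _ _ _ _ _ _ (ba1_variation _ mu1) bf mc (ltW e20) fa.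
suff : - (e / 2) <= \sum_i a i * mu (c @^-1` [set i]).
  by rewrite ler_norml mulr1 => ? /andP[]; lra.
rewrite -[leLHS]mulr1 -[X in _ * X]mu1.2 -(ba_sum_colouring mu _ mc) mulr_sumr ler_sum// => i _.
have [[x /= <-]|n0] := pselect (exists x, c x = i).
  rewrite ler_wpM2r//; first exact: mu1.1.
  by have := fa x; have := f0 x; rewrite ler_norml => ? /andP[]; lra.
rewrite (_ : _ @^-1` _ = set0) ?ba_set0 ?mulr0//.
by apply/seteqP; split=> // x cbx; case: n0; exists x.
Qed.

Lemma ba_integral_le mu f g : ba1 mu -> Bb T R f -> Bb T R g -> (forall x, f x <= g x) ->
  ba_integral mu f <= ba_integral mu g.
Proof.
move=> mu1 bf bg fg; rewrite -subr_ge0 -ba_integralB//.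
by apply: ba_integral_ge0 => // [|x]; [exact: BbB|rewrite subr_ge0].
Qed.

Lemma ba_integral_norm_le mu f (N : R) : ba1 mu -> Bb T R f ->
  (forall x, `|f x| <= N) -> `|ba_integral mu f| <= N.
Proof.
move=> mu1 bf fN; rewrite ler_norml; apply/andP; split.
  have := ba_integral_le mu _ _ mu1 (Bb_cst (- N)) bf.
  rewrite ba_integral_cst mu1.2 mulr1; apply => x.
  by have := fN x; rewrite ler_norml => /andP[].
have := ba_integral_le mu _ _ mu1 bf (Bb_cst N).
rewrite ba_integral_cst mu1.2 mulr1; apply => x.
by have := fN x; rewrite ler_norml => /andP[].
Qed.

Lemma ba_of_probabilityE (p : probability T R) A : measurable A ->
  ba_of_probability p A = fine (p A).
Proof. by move=> mA; rewrite /= /set_fun_of_probability asboolT. Qed.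

Lemma ba1_probability (p : probability T R) : ba1 (ba_of_probability p).
Proof.
split=> [A mA|]; rewrite ba_of_probabilityE//; first exact: fine_ge0.
by rewrite probability_setT.
Qed.

Lemma Bb_integrable (p : probability T R) f : Bb T R f -> p.-integrable setT (EFin \o f).
Proof.
move=> [mf [M fM]]; apply: measurable_bounded_integrable => //.
  by rewrite (le_lt_trans (probability_le1 _ _))// ltry.
exists M; split; first exact: num_real.
by move=> N MN x _ /=; rewrite (le_trans (fM x))// ltW.
Qed.

(** The function is a finite combination of indicators of cells, each of which
    integrates to the mass of its cell. *)
Lemma Rintegral_colouring (p : probability T R) {I : finType} (c : T -> I) (a : I -> R) :
  mcolouring c ->
  \int[p]_x a (c x) = \sum_i a i * ba_of_probability p (c @^-1` [set i]).
Proof.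
move=> mc; rewrite /Rintegral.
have E x : (a (c x))%:E = (\sum_i (a i)%:E * (\1_(c @^-1` [set i]) x)%:E)%E.
  rewrite (bigD1 (c x))//= big1 ?adde0 => [|i ic].
    by rewrite indicE mem_set// mule1.
  by rewrite indicE memNset ?mule0//= => /esym /eqP; rewrite (negPf ic).
under eq_integral do rewrite E.
have bi i : Bb T R (\1_(c @^-1` [set i])) by exact: Bb_indic.
rewrite integral_sum// => [|i]; last first.
  by apply: integrableZl => //; exact: (Bb_integrable _ _ (bi i)).
have Ei i : (\int[p]_x ((a i)%:E * (\1_(c @^-1` [set i]) x)%:E) =
    (a i * ba_of_probability p (c @^-1` [set i]))%:E)%E.
  rewrite integralZl//; last exact: (Bb_integrable _ _ (bi i)).
  rewrite integral_indic// setIT ba_of_probabilityE// EFinM fineK//.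
  by apply: fin_num_measure; exact: mc.
under eq_bigr do rewrite Ei.
by rewrite sumEFin.
Qed.

(** The Lebesgue integral is monotone, so it stays within [e] of the Riemann sums
    of an [e]-approximation, which characterizes the finitely additive
    integral. *)
Lemma ba_integral_probability (p : probability T R) f : Bb T R f ->
  ba_integral (ba_of_probability p) f = \int[p]_x f x.
Proof.
move=> bf; apply: (@ba_integral_eq _ _ _ 1) => // I c a e mc e0 fa.
rewrite -Rintegral_colouring//.
have H g h : Bb T R g -> Bb T R h -> (forall x, g x <= h x + e) ->
    \int[p]_x g x <= \int[p]_x h x + e.
  move=> bg bh gh; have be := Bb_cst e.
  have <- : \int[p]_x (h x + e) = \int[p]_x h x + e.
    rewrite RintegralD//; [|exact: Bb_integrable..].
    rewrite Rintegral_cst//; congr (_ + _); rewrite -[RHS]mulr1; congr (_ * _).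
    exact: (congr1 fine (probability_setT p)).
  apply: le_Rintegral => //; [exact: Bb_integrable|exact: (Bb_integrable _ _ (BbD _ _ bh be))].
rewrite mulr1 ler_norml; apply/andP; split.
  rewrite lerBrDr addrC lerBlDr; apply: H => //; first exact: mcolouring_comp.
  by move=> x; have := fa x; rewrite ler_norml => /andP[]; lra.
rewrite lerBlDr addrC; apply: H => //; first exact: mcolouring_comp.
by move=> x; have := fa x; rewrite ler_norml => /andP[]; lra.
Qed.

Lemma expectation_ba (p : probability T R) f : Bb T R f ->
  'E_p[f]%E = (ba_integral (ba_of_probability p) f)%:E.
Proof.
move=> bf; rewrite ba_integral_probability// unlock /Rintegral fineK//.
exact: (integrable_fin_num _ (Bb_integrable p f bf)).
Qed.

End integral_theory.

(** * Compactness of the set of finitely additive probabilities *)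

(** An ultrafilter clusters only where it converges, and a bounded segment is
    compact. *)
Lemma ultra_cvg_bounded {X : Type} {R : realType} (F : set_system X) (u : X -> R) (M : R) :
  UltraFilter F -> F [set x | `|u x| <= M] -> cvg (u @ F).
Proof.
move=> UF FM.
have PF : ProperFilter F by exact: ultra_proper.
have [|l [_ clul]] := @segment_compact R (- M) M (u @ F) (fmap_proper_filter u PF).
  by apply: (@filterS _ F _ _ _ _ FM) => x ux; rewrite /= in_itv/= -ler_norml.
apply/cvg_ex; exists l => U Ul /=.
have [//|FU] := in_ultra_setVsetC (u @^-1` U) UF.
by have [y [nUy /nUy]] := clul (~` U) U FU Ul.
Qed.

Section convex_subsets.
Context {R : realType} {E : lmodType R}.

Definition lmod_convex (K : set E) := forall (t : R) x y, 0 <= t <= 1 -> K x -> K y ->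
  K (t *: x + (1 - t) *: y).

Lemma lmod_convexP (K : set E) :
  lmod_convex K <-> convex_set (K : set (convex_lmodType E)).
Proof.
split=> [cK x y t|cK t x y t01 Kx Ky].
  by rewrite !inE; apply: cK; apply/andP; split.
pose t' : {i01 R} := @Itv01 R t (andP t01).1 (andP t01).2.
by have := cK x y t'; rewrite !inE; apply.
Qed.

End convex_subsets.

Section weak_star.
Context {d : measure_display} {T : measurableType d} {R : realType}.
Implicit Types (mu nu : ba T R) (f g : T -> R).

Lemma ba_integral_continuous f : Bb T R f ->
  continuous (fun mu : ba T R => ba_integral mu f).
Proof.
move=> bf mu.
pose f' : Bb T R := exist _ f (mem_set bf).
have H0 := @initial_continuous _ _ (@ba_eval d T R) mu.
have FF : Filter (@ba_eval d T R @ nbhs mu) by typeclasses eauto.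
have H := (@cvg_sup _ _ _ _ _ FF).1 H0 f'.
move=> U /= [e e0 eU].
suff: (@ba_eval d T R @ nbhs mu) ((fun h => h f') @^-1` U) by [].
apply: H.
exists ((fun h : {ptws (Bb T R) -> R} => h f') @^-1` (ball (ba_integral mu f) e)).
split => //=; last first.
  by move=> h /= hf; apply: eU.
  by exact: ballxx.
by exists (ball (ba_integral mu f) e) => //; exact: ball_open.
Qed.

(** In an initial topology, convergence of the evaluations is convergence. *)
Lemma ba_cvg (F : set_system (ba T R)) mu : Filter F ->
  (forall f, Bb T R f -> ba_integral nu f @[nu --> F] --> ba_integral mu f) -> F --> mu.
Proof.
move=> FF H A [B [[W oW <-] Wm] WA].
suff : @ba_eval d T R @ F --> ba_eval mu.
  by move=> /(_ W) HW; apply: filterS WA _; apply: HW; exact: open_nbhs_nbhs.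
apply/cvg_sup => -[f bf] U [V [[Y] oY <-] Yf YU].
apply: (filterS YU); apply: (H f (set_mem bf)).
exact: open_nbhs_nbhs.
Qed.

(** Along an ultrafilter each mass [mu A], lying in [0, 1], has a limit [m A];
    additivity passes to the limit, and so do the integrals of bounded functions,
    which are uniform limits of Riemann sums. *)
Lemma ba1_compact : compact (@ba1 d T R).
Proof.
rewrite compact_ultra => F UF F1.
have PF : ProperFilter F by exact: ultra_proper.
have mu0 mu A : ~ measurable A -> mu A = 0.
  by move=> nmA; have /asboolP[/(_ A nmA)] := ba_valP mu.
have muD mu A B : measurable A -> measurable B -> A `&` B = set0 -> mu (A `|` B) = mu A + mu B.
  by move=> mA mB AB; have /asboolP[_ /(_ A B mA mB AB)] := ba_valP mu.
have b1 mu A : ba1 mu -> `|mu A| <= 1.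
  move=> [mu_ge0 muT]; have [mA|nmA] := pselect (measurable A); last by rewrite mu0// normr0.
  rewrite ger0_norm ?mu_ge0// -muT -(setUv A) muD//; last exact: setICr.
    by rewrite lerDl mu_ge0//; exact: measurableC.
  exact: measurableC.
have cv A : cvg ((fun mu : ba T R => mu A) @ F).
  apply: (@ultra_cvg_bounded _ _ _ _ 1) => //.
  by apply: (@filterS _ F _ _ _ _ F1) => mu; exact: b1.
pose m A := lim ((fun mu : ba T R => mu A) @ F).
have m_ge0 A : measurable A -> 0 <= m A.
  move=> mA; apply: limr_ge => //.
  by apply: (@filterS _ F _ _ _ _ F1) => mu [mu_ge0 _]; exact: mu_ge0.
have m1 A : m A <= 1.
  apply: limr_le => //; apply: (@filterS _ F _ _ _ _ F1) => mu m1.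
  by rewrite (le_trans (ler_norm _))// b1.
have mba : m \in ba_pred (R := R).
  apply/asboolP; split.
  - move=> A nmA; apply: cvg_lim => //.
    by apply: cvg_near_cst; apply: nearW => mu; exact: mu0.
  - move=> A B mA mB AB; apply: cvg_lim => //.
    rewrite (_ : (fun _ => _) = (fun mu : ba T R => mu A + mu B)).
      by apply: cvgD; exact: cv.
    by apply/funext => mu; exact: muD.
  - by exists 1 => A mA; rewrite ger0_norm// m_ge0.
have bm : ba1 (Ba mba).
  split; first exact: m_ge0.
  rewrite /= /m; apply: cvg_lim => //; apply: cvg_near_cst.
  by apply: (@filterS _ F _ _ _ _ F1) => mu [].
exists (Ba mba); split => //=.
apply: ba_cvg => f bf; apply/cvgrPdist_le => e e0.
have e30 : 0 < e / 3 by rewrite divr_gt0.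
have [I [c [a [mc /(_ _)/ltW fa]]]] := Bb_colouring_approx _ _ bf e30.
have : \sum_i a i * mu (c @^-1` [set i]) @[mu --> F] --> \sum_i a i * m (c @^-1` [set i]).
  elim: (index_enum I) => [|i r ih].
    by under eq_fun do rewrite big_nil; rewrite big_nil; exact: cvg_cst.
  under eq_fun do rewrite big_cons; rewrite big_cons.
  by apply: cvgD => //; apply: cvgMr; exact: cv.
move=> /cvgrPdist_le/(_ _ e30) near_sum.
apply: (@filterS _ F _ _ _ _ (filterI F1 near_sum)) => nu [nu1 /= Snu].
have h1 := ba_integral_approx _ _ _ _ _ _ (ba1_variation _ bm) bf mc (ltW e30) fa.
have h2 := ba_integral_approx _ _ _ _ _ _ (ba1_variation _ nu1) bf mc (ltW e30) fa.
move: h1 h2 Snu; rewrite !mulr1/= !ler_norml; lra.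
Qed.

Lemma ba_integral_indic mu A : measurable A -> ba_integral mu (\1_A) = mu A.
Proof.
move=> mA; have mc : mcolouring (fun x => x \in A).
  case.
    rewrite (_ : _ @^-1` _ = A)//; apply/seteqP.
    by split=> x /=; [exact: set_mem|exact: mem_set].
  rewrite (_ : _ @^-1` _ = ~` A); first exact: measurableC.
  apply/seteqP; split=> x /=; last exact: memNset.
  by move=> xA Ax; rewrite mem_set in xA.
rewrite -[LHS]/(ba_integral mu (fun x => (fun b : bool => b%:R : R) (x \in A))).
rewrite (ba_integral_colouring _ _ (fun b : bool => b%:R : R) mc).
rewrite big_bool/= mul1r mul0r addr0; congr (mu _).
by apply/seteqP; split=> x /=; [exact: set_mem|exact: mem_set].
Qed.

Lemma closed_ba_integral_ge f (k : R) : Bb T R f ->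
  closed [set mu : ba T R | k <= ba_integral mu f].
Proof.
move=> bf.
rewrite (_ : mkset _ = (fun mu : ba T R => ba_integral mu f) @^-1` [set y | k <= y])//.
by apply: closed_comp; [move=> mu _; exact: ba_integral_continuous|exact: closed_ge].
Qed.

Lemma closed_ba_integral_le f (k : R) : Bb T R f ->
  closed [set mu : ba T R | ba_integral mu f <= k].
Proof.
move=> bf.
rewrite (_ : mkset _ = (fun mu : ba T R => ba_integral mu f) @^-1` [set y | y <= k])//.
by apply: closed_comp; [move=> mu _; exact: ba_integral_continuous|exact: closed_le].
Qed.

(** Nonnegativity and unit mass are closed conditions because [mu A] is the
    integral of the indicator of [A]. *)
Lemma ba1_closed : closed (@ba1 d T R).
Proof.
pose S (A : set T) : set (ba T R) := [set mu | 0 <= ba_integral mu (\1_A)].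
rewrite (_ : @ba1 d T R = (\bigcap_(A in @measurable d T) S A) `&`
   ([set mu | ba_integral mu (\1_setT) <= 1] `&` [set mu | 1 <= ba_integral mu (\1_setT)])).
  apply: closedI.
    by apply: closed_bigI => A mA; apply: closed_ba_integral_ge; exact: Bb_indic.
  by apply: closedI; [apply: closed_ba_integral_le|apply: closed_ba_integral_ge];
    exact: Bb_indic.
apply/seteqP; split=> [mu [mu0 mu1]|mu [mu0 [/= mule muge]]].
  split=> [A mA|]; first by rewrite /S/= ba_integral_indic// mu0.
  by split; rewrite /= ba_integral_indic// mu1.
split=> [A mA|]; first by have := mu0 A mA; rewrite /S/= ba_integral_indic.
by apply/eqP; rewrite eq_le -ba_integral_indic// mule.
Qed.

Definition convex_hull (A : set (ba T R)) : set (ba T R) := smallest (@convex_set R (ba T R)) A.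

Lemma convex_hull_sub A (S : set (ba T R)) : lmod_convex S -> A `<=` S -> convex_hull A `<=` S.
Proof. by move=> /lmod_convexP cS AS; apply: smallest_sub. Qed.

Lemma sub_convex_hull A : A `<=` convex_hull A.
Proof. exact: sub_gen_smallest. Qed.

Lemma convex_hull_convex A : lmod_convex (convex_hull A).
Proof.
move=> t mu nu t01 Hmu Hnu S [cS AS].
have /lmod_convexP coS := cS.
apply: coS => //; [exact: Hmu|exact: Hnu].
Qed.

Lemma closed_convex_hull_sub A (S : set (ba T R)) : closed S -> lmod_convex S -> A `<=` S ->
  closed_convex_hull A `<=` S.
Proof.
move=> cS coS AS; rewrite /closed_convex_hull.
have /closure_id -> := cS.
by apply: closureS; exact: convex_hull_sub.
Qed.

Lemma convex_hull_closed_convex_hull A : convex_hull A `<=` closed_convex_hull A.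
Proof. exact: subset_closure. Qed.

Lemma closed_convex_hull_closed A : closed (@closed_convex_hull d T R A).
Proof. exact: closed_closure. Qed.

Lemma ba1_convex : lmod_convex (@ba1 d T R).
Proof.
move=> t mu nu /andP[t0 t1] [mu0 mu1] [nu0 nu1].
have E A : (t *: mu + (1 - t) *: nu : ba T R) A = t * mu A + (1 - t) * nu A by [].
split=> [A mA|]; rewrite E; last by rewrite mu1 nu1; ring.
by rewrite addr_ge0// mulr_ge0 ?mu0 ?nu0// subr_ge0.
Qed.

Lemma closed_convex_hull_ba1 (P : set (probability T R)) :
  closed_convex_hull (@ba_of_probability d T R @` P) `<=` ba1.
Proof.
apply: closed_convex_hull_sub; [exact: ba1_closed|exact: ba1_convex|].
by move=> _ [p _ <-]; exact: ba1_probability.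
Qed.

Lemma closed_convex_hull_compact (P : set (probability T R)) :
  compact (closed_convex_hull (@ba_of_probability d T R @` P)).
Proof.
apply: subclosed_compact ba1_compact _; first exact: closed_convex_hull_closed.
exact: closed_convex_hull_ba1.
Qed.

Lemma closed_convex_hull_integral_le (P : set (probability T R)) f (k : R) mu : Bb T R f ->
  (forall p, P p -> \int[p]_x f x <= k) ->
  closed_convex_hull (@ba_of_probability d T R @` P) mu -> ba_integral mu f <= k.
Proof.
move=> bf fk; move: mu; apply: closed_convex_hull_sub; first exact: closed_ba_integral_le.
  move=> t mu nu /andP[t0 t1] /= muk nuk; rewrite ba_integral_comb//; nra.
by move=> _ [p Pp <-] /=; rewrite ba_integral_probability// fk.
Qed.

Lemma closed_convex_hull_integral_ge (P : set (probability T R)) f (k : R) mu : Bb T R f ->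
  (forall p, P p -> k <= \int[p]_x f x) ->
  closed_convex_hull (@ba_of_probability d T R @` P) mu -> k <= ba_integral mu f.
Proof.
move=> bf fk; move: mu; apply: closed_convex_hull_sub; first exact: closed_ba_integral_ge.
  move=> t mu nu /andP[t0 t1] /= muk nuk; rewrite ba_integral_comb//; nra.
by move=> _ [p Pp <-] /=; rewrite ba_integral_probability// fk.
Qed.

End weak_star.

(** * Minimax for finitely many affine payoffs *)

Section minimax.
Context {R : realType} {E : lmodType R}.
Implicit Types (K : set E) (a b : E -> R).

Definition affine_on K a := forall (t : R) x y, 0 <= t <= 1 -> K x -> K y ->
  a (t *: x + (1 - t) *: y) = t * a x + (1 - t) * a y.

(** With [a] and [b] recentred at [c], the slopes [s] with [0 <= a + s b] on [K]
    are bounded below by the points where [a < 0] and above by those where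
    [b < 0]; the bounds are compatible since otherwise a mixture of two such
    points would make both functions negative.  The weight is then
    [t = 1 / (1 + s)]. *)
Lemma affine_alternative2 K a b (c : R) : lmod_convex K -> affine_on K a -> affine_on K b ->
  (forall x, K x -> c <= a x \/ c <= b x) ->
  exists2 t, 0 <= t <= 1 & forall x, K x -> c <= t * a x + (1 - t) * b x.
Proof.
move=> cK aa ab alt.
have [[x0 Kx0 bx0]|nb] := pselect (exists2 x, K x & b x < c); last first.
  exists 0; [by rewrite lexx ler01|move=> x Kx; rewrite mul0r add0r subr0 mul1r].
  by rewrite leNgt; apply/negP => bx; apply: nb; exists x.
have [[y0 Ky0 ay0]|na] := pselect (exists2 y, K y & a y < c); last first.
  exists 1; [by rewrite lexx ler01|move=> x Kx; rewrite subrr mul0r addr0 mul1r].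
  by rewrite leNgt; apply/negP => ax; apply: na; exists x.
have ax x : K x -> b x < c -> c <= a x.
  by move=> Kx bx; have [//|] := alt x Kx; rewrite leNgt bx.
have by_ y : K y -> a y < c -> c <= b y.
  by move=> Ky ay; have [|//] := alt y Ky; rewrite leNgt ay.
have cross x y : K x -> K y -> b x < c -> a y < c ->
    (a y - c) * (b x - c) <= (a x - c) * (b y - c).
  move=> Kx Ky bx ay; rewrite leNgt; apply/negP => lt.
  have := ax x Kx bx; have := by_ y Ky ay => ycb xca.
  (* The mixing ratio p / q is the mediant of the two ratios at which the mixture
     of b, respectively of a, reaches the level c, so it lies strictly between. *)
  pose p := b y - a y; pose q := a x - b x.
  have p0 : 0 < p by rewrite /p; lra.
  have q0 : 0 < q by rewrite /q; lra.
  pose t := p / (p + q).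
  have pq0 : 0 < p + q by exact: addr_gt0.
  have t01 : 0 <= t <= 1.
    apply/andP; split; first by rewrite divr_ge0// ltW.
    by rewrite /t ler_pdivrMr// mul1r lerDl ltW.
  have Et u v : t * u + (1 - t) * v = (p * u + q * v) / (p + q).
    rewrite /t; field; exact: lt0r_neq0.
  have := alt _ (cK t x y t01 Kx Ky); rewrite aa// ab// !Et !ler_pdivlMr//.
  by rewrite /p /q; case; apply/negP; rewrite -ltNge; lra.
have bpos y : K y -> a y < c -> 0 < b y - c.
  move=> Ky ay; have := cross x0 y Kx0 Ky bx0 ay.
  have := ax x0 Kx0 bx0; have := by_ y Ky ay; nra.
pose S := [set (c - a y) / (b y - c) | y in [set y | K y /\ a y < c]].
have ubS x : K x -> b x < c -> ubound S ((a x - c) / (c - b x)).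
  move=> Kx bx _ [y [Ky ay] <-]; have yb := bpos y Ky ay.
  have xb : 0 < c - b x by lra.
  rewrite ler_pdivrMr// mulrAC ler_pdivlMr//; have := cross x y Kx Ky bx ay; lra.
have hS : has_sup S.
  split; first by exists ((c - a y0) / (b y0 - c)); exists y0.
  by exists ((a x0 - c) / (c - b x0)); exact: ubS.
pose s := sup S.
have Ss y : K y -> a y < c -> (c - a y) / (b y - c) <= s.
  by move=> Ky ay; apply: (ub_le_sup hS.2); exists y.
have s0 : 0 <= s.
  by apply: le_trans (Ss y0 Ky0 ay0); rewrite divr_ge0// ?ltW// ?bpos// subr_gt0.
have s1 : 0 < 1 + s by rewrite ltr_pwDl.
exists (1 + s)^-1.
  by rewrite invr_ge0 (ltW s1)/= invf_le1// lerDl.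
move=> z Kz.
have -> : (1 + s)^-1 * a z + (1 - (1 + s)^-1) * b z = (a z + s * b z) / (1 + s).
  by field; exact: lt0r_neq0.
rewrite ler_pdivlMr//.
suff : 0 <= (a z - c) + s * (b z - c) by lra.
have [az|az] := ltP (a z) c.
  have := Ss z Kz az; rewrite ler_pdivrMr ?bpos//; lra.
have [bz|bz] := ltP (b z) c; last by rewrite addr_ge0 ?mulr_ge0// subr_ge0.
have : s <= (a z - c) / (c - b z) by apply: ge_sup; [exact: hS.1|exact: ubS].
rewrite ler_pdivlMr ?subr_gt0//; lra.
Qed.

(** Induction on the list: on the convex subset of [K] where [phi j < c] the
    remaining functions still cover, so one of the family is at least [c] there;
    [affine_alternative2] mixes it with [phi j], and the mixture is dominated by
    a member of the family. *)
Lemma finite_minimax (I : Type) (phi : I -> E -> R) (c : R) (s : seq I) K :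
  inhabited I -> lmod_convex K -> (forall i, affine_on K (phi i)) ->
  (forall i j t, 0 <= t <= 1 ->
    exists k, forall x, K x -> t * phi i x + (1 - t) * phi j x <= phi k x) ->
  (forall x, K x -> exists2 i, List.In i s & c <= phi i x) ->
  exists i, forall x, K x -> c <= phi i x.
Proof.
move=> [i0]; elim: s K => [|j s ih] K cK affK conv cover.
  by exists i0 => x /cover[].
have [t x y t01 [Kx xj] [Ky yj]| | | |i Hi] := ih [set x | K x /\ phi j x < c].
- split; first exact: cK.
  rewrite affK//; move/andP: t01 => [t0 t1].
  have -> : c = t * c + (1 - t) * c by ring.
  have [->|tn0] := eqVneq t 0; first by rewrite !mul0r !add0r subr0 !mul1r.
  rewrite ltr_leD ?ltr_pM2l ?ler_wpM2l ?subr_ge0 ?(ltW yj)//.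
  by rewrite lt_neqAle eq_sym tn0.
- by move=> i t x y t01 [Kx _] [Ky _]; exact: affK.
- by move=> i k t t01; have [l Hl] := conv i k t t01; exists l => x [Kx _]; exact: Hl.
- move=> x [Kx xj]; have [i [<-|si]] := cover x Kx; first by rewrite leNgt xj.
  by exists i.
have [x Kx|t t01 Ht] := affine_alternative2 K (phi i) (phi j) c cK (affK i) (affK j).
  have [|] := leP c (phi j x); first by right.
  by left; apply: Hi.
have [k Hk] := conv i j t t01.
by exists k => x Kx; exact: le_trans (Ht x Kx) (Hk x Kx).
Qed.

End minimax.

(** * Finite intersections and attained minima *)

Lemma compact_fip {X : topologicalType} (I : Type) (K : set X) (C : I -> set X) :
  compact K -> (forall i, closed (C i)) ->
  (forall s : seq I, exists2 x, K x & forall i, List.In i s -> C i x) ->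
  exists2 x, K x & forall i, C i x.
Proof.
move=> cK cC fip.
pose B (s : seq I) := [set x | K x /\ forall i, List.In i s -> C i x].
have FB : ProperFilter (filter_from setT B).
  apply: filter_from_proper => [|s _]; last by have [x Kx Cx] := fip s; exists x.
  apply: filter_from_filter; first by exists [::].
  move=> s t _ _; exists (s ++ t) => // x [Kx Cx].
  by split; split=> // i si; apply: Cx; apply/List.in_app_iff; [left|right].
have [|x [Kx clx]] := cK _ FB; first by exists [::] => // x [].
exists x => // i; apply: (cC i) => U Ux.
have [|y [[_ Cy] Uy]] := clx (B [:: i]) U _ Ux; first by exists [:: i].
by exists y; split => //; apply: Cy; left.
Qed.

Section attainment.
Context {R : realType} {X : topologicalType}.

(** Testing against reals avoids a case analysis on infinite values. *)
Lemma lee_real_bounds (x y : \bar R) :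
  (forall c : R, (y < c%:E)%E -> (x <= c%:E)%E) -> (x <= y)%E.
Proof.
case: y => [r||] H; [|exact: leey|].
  apply/lee_addgt0Pr => e e0; rewrite -EFinD; apply: H.
  by rewrite lte_fin ltrDl.
case: x H => [r H||//]; last by move=> /(_ 0%R (ltNyr _)); rewrite leye_eq.
by have := H (r - 1)%R (ltNyr _); rewrite lee_fin  lerBrDr gerDl ler10.
Qed.

(** The sublevel sets above the infimum are nonempty, nested and compact; a
    common point is a minimizer.  The hypothesis presents each sublevel set as the
    trace on [K] of a closed set, which is lower semicontinuity on [K]. *)
Lemma attains_min_compact (K : set X) (F : X -> \bar R) (C : R -> set X) :
  compact K -> K !=set0 -> (forall c, closed (C c)) ->
  (forall c x, K x -> (F x <= c%:E)%E <-> C c x) -> attains_min K F.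
Proof.
move=> cK [x0 Kx0] cC FC; set m := ereal_inf (F @` K).
have mF x : K x -> (m <= F x)%E by move=> Kx; apply: ereal_inf_lbound; exists x.
have [mE|] := eqVneq m +oo%E.
  by exists x0 => //; apply/eqP; rewrite eq_le mF// -/m mE leey.
rewrite -ltey => mlty.
have [r0 mr0] : exists r : R, (m < r%:E)%E.
  case: (m) mlty => [r _|//|_]; last by exists 0%R; rewrite ltNyr.
  by exists (r + 1)%R; rewrite // lte_fin ltrDl.
pose I := {c : R | (m < c%:E)%E}.
have [s|x Kx Cx] := @compact_fip X I K (fun c => C (sval c)) cK (fun c => cC (sval c)).
  (* Finitely many levels above the infimum have a common lower bound above it. *)
  have [c mc cs] : exists2 c : R, (m < c%:E)%E & forall i, List.In i s -> c <= sval i.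
    elim: s => [|i s [c mc cs]].
      by exists r0.
    exists (Num.min c (sval i)); first by rewrite EFin_min lt_min mc (svalP i).
    move=> k [<-|/cs ck]; first by rewrite ge_min lexx orbT.
    by rewrite ge_min ck.
  have [_ [x Kx <-] Fxc] := ereal_inf_lt mc.
  exists x => // i /cs ci; apply/FC => //.
  by rewrite (le_trans (ltW Fxc))// lee_fin.
exists x => //; apply/eqP; rewrite eq_le mF// andbT -/m.
apply: lee_real_bounds => c mc; apply/FC => //.
exact: (Cx (exist _ c mc)).
Qed.

End attainment.

(** * Variational formula for the relative entropy *)

Section entropy_term.
Context {R : realType}.
Implicit Types q p r t : R.

(** Together with [entropy_term_gt], this says that
    [q ln (q / p) = sup_t (q t - p e^t + q)] for all [q, p >= 0], with the
    conventions at 0; the inequality is the tangent bound [1 + u <= e^u] at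
    [u = t - ln (q / p)]. *)
Lemma entropy_term_ge q p t : 0 <= q -> 0 <= p ->
  ((q * t - p * expR t + q)%:E <= entropy_term q p)%E.
Proof.
move=> q0 p0; rewrite /entropy_term.
have [->|qn0] := eqVneq q 0.
  by rewrite lee_fin mul0r add0r addr0 oppr_le0 mulr_ge0// expR_ge0.
have [->|pn0] := eqVneq p 0; first exact: leey.
have {}q0 : 0 < q by rewrite lt_neqAle eq_sym qn0.
have {}p0 : 0 < p by rewrite lt_neqAle eq_sym pn0.
have qp : 0 < q / p by rewrite divr_gt0.
have := expR_ge1Dx (t - ln (q / p)).
rewrite expRD expRN lnK ?posrE// => H.
have : q * (1 + (t - ln (q / p))) <= q * (expR t / (q / p)) by rewrite ler_wpM2l// ltW.
have -> : q * (expR t / (q / p)) = p * expR t by field; rewrite qn0 pn0.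
by rewrite lee_fin; lra.
Qed.

(** For [q, p > 0] the supremum is attained at [t = ln (q / p)]; it is
    approached as [t] tends to [-oo] if [q = 0] and to [+oo] if [p = 0 < q]. *)
Lemma entropy_term_gt q p r : 0 <= q -> 0 <= p ->
  (r%:E < entropy_term q p)%E -> exists t, r < q * t - p * expR t + q.
Proof.
move=> q0 p0; rewrite /entropy_term.
have [->|qn0] := eqVneq q 0.
  rewrite lte_fin => r0.
  have [->|pn0] := eqVneq p 0; first by exists 0; lra.
  have {}p0 : 0 < p by rewrite lt_neqAle eq_sym pn0.
  (* With this t, p e^t = - r / 2, half of the available gap. *)
  exists (ln (- r / (2 * p))); rewrite lnK ?posrE ?divr_gt0 ?mulr_gt0 ?oppr_gt0//.
  have -> : p * (- r / (2 * p)) = - r / 2 by field.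
  lra.
have {}q0 : 0 < q by rewrite lt_neqAle eq_sym qn0.
have [->|pn0] := eqVneq p 0.
  by move=> _; exists (r / q); rewrite mulrC divfK//; lra.
have {}p0 : 0 < p by rewrite lt_neqAle eq_sym pn0.
rewrite lte_fin => rq; exists (ln (q / p)); rewrite lnK ?posrE ?divr_gt0//.
have -> : p * (q / p) = q by field.
lra.
Qed.

Lemma lte_addE_real (x y : \bar R) (r : R) : (-oo < x)%E -> (-oo < y)%E -> (r%:E < x + y)%E ->
  exists a b : R, [/\ (a%:E < x)%E, (b%:E < y)%E & r < a + b].
Proof.
case: x y => [x| |//] [y| |//] _ _.
- rewrite -EFinD lte_fin => rxy; pose e := (x + y - r) / 3.
  by exists (x - e), (y - e); rewrite !lte_fin /e; split; lra.
- by move=> _; exists (x - 1), (r - x + 2); rewrite lte_fin ltry; split => //; lra.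
- by move=> _; exists (r - y + 2), (y - 1); rewrite lte_fin ltry; split => //; lra.
- by move=> _; exists 0, (r + 1); rewrite !ltry; split => //; lra.
Qed.

Lemma sum_entropy_term_gt {I : eqType} (s : seq I) (q p : I -> R) r : uniq s ->
  (forall i, 0 <= q i) -> (forall i, 0 <= p i) ->
  (r%:E < \sum_(i <- s) entropy_term (q i) (p i))%E ->
  exists t : I -> R, r < \sum_(i <- s) (q i * t i - p i * expR (t i) + q i).
Proof.
move=> + q0 p0; elim: s r => [|i s ih] r.
  by move=> _; rewrite big_nil lte_fin => r0; exists (fun=> 0); rewrite big_nil.
have gtNy j : (-oo < entropy_term (q j) (p j))%E.
  by apply: lt_le_trans (entropy_term_ge _ _ 0 (q0 j) (p0 j)); exact: ltNyr.
rewrite /= big_cons => /andP[ins us] /lte_addE_real[||a [b [ai bs rab]]]; first exact: gtNy.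
  apply: lt_le_trans (lee_sum s (fun j _ => entropy_term_ge _ _ 0 (q0 j) (p0 j))).
  by rewrite sumEFin ltNyr.
have [t0 ht0] := entropy_term_gt _ _ _ (q0 i) (p0 i) ai.
have [t ht] := ih _ us bs.
exists (fun j => if j == i then t0 else t j).
rewrite big_cons eqxx (lt_trans rab)// ltrD//.
rewrite (eq_big_seq (fun i => q i * t i - p i * expR (t i) + q i))// => j js.
by case: eqVneq => // ji; move: ins; rewrite -ji js.
Qed.

End entropy_term.

Section entropy_duality.
Context {d : measure_display} {T : measurableType d} {R : realType}.
Implicit Types (mu nu : ba T R) (f g : T -> R).

(** A partition is required to have nonempty cells, so the empty ones, which
    contribute [0 ln (0 / 0) = 0], are discarded first. *)
Lemma colouring_le_relative_entropy mu nu {I : finType} (c : T -> I) : mcolouring c ->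
  (\sum_i entropy_term (nu (c @^-1` [set i])) (mu (c @^-1` [set i]))
    <= relative_entropy nu mu)%E.
Proof.
move=> mc; pose D := [pred i : I | `[< (c @^-1` [set i]) !=set0 >]].
rewrite (bigID D)/= [X in (_ + X)%E]big1 ?adde0 => [|i /asboolPn ci]; last first.
  have -> : c @^-1` [set i] = set0 by apply/eqP/negP => /negP/set0P.
  by rewrite !ba_set0 /entropy_term eqxx.
rewrite big_enum_val/=; apply: ereal_sup_ubound.
exists #|D|, (fun k => c @^-1` [set enum_val k]); split => //.
split.
- rewrite -subTset => x _.
  have Dx : c x \in D by apply/asboolP; exists x.
  by exists (enum_rank_in Dx (c x)) => //=; rewrite enum_rankK_in.
- move=> k l _ _ [x [/= -> /enum_val_inj //]].
- by move=> k _; have /asboolP := enum_valP k.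
Qed.

(** Easy half of the variational formula.  The step function [b] lies between
    [f - e] and [f], so replacing [f] by [b] lowers the first integral by at most
    [e] and does not increase the second; on steps the bound holds cell by
    cell. *)
Lemma ba_integral_le_relative_entropy mu nu f : ba1 nu -> ba1 mu -> Bb T R f ->
  ((1 + ba_integral nu f - ba_integral mu (fun x => expR (f x)))%:E
    <= relative_entropy nu mu)%E.
Proof.
move=> nu1 mu1 bf; apply/lee_addgt0Pr => e e0.
have e20 : 0 < e / 2 by rewrite divr_gt0.
have [I [c [a [mc fa]]]] := Bb_colouring_approx _ _ bf e20.
pose b i := a i - e / 2.
have bb := mcolouring_comp _ b mc.
have := colouring_le_relative_entropy mu nu _ mc; set S := (X in (X <= _)%E) => HS.
have bS : ((1 + ba_integral nu (fun x => b (c x)) -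
    ba_integral mu (fun x => expR (b (c x))))%:E <= S)%E.
  rewrite ba_integral_colouring// (ba_integral_colouring _ _ (fun i => expR (b i)))//.
  rewrite -nu1.2 -(ba_sum_colouring nu _ mc).
  rewrite -big_split/= -sumrB -sumEFin; apply: lee_sum => i _.
  apply: le_trans (entropy_term_ge _ _ (b i) (nu1.1 _ (mc i)) (mu1.1 _ (mc i))).
  by rewrite lee_fin; lra.
apply: (@le_trans _ _ (S + e%:E)%E); last by rewrite leeD2r.
apply: le_trans (leeD2r _ bS); rewrite -EFinD lee_fin.
have h1 : ba_integral mu (fun x => expR (b (c x))) <= ba_integral mu (fun x => expR (f x)).
  apply: ba_integral_le => //; [exact: Bb_expR|exact: Bb_expR|].
  by move=> x; rewrite ler_expR; have := fa x; rewrite /b ltr_norml; lra.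
have h2 : ba_integral nu f <= ba_integral nu (fun x => b (c x) + e).
  apply: ba_integral_le => //; first by apply: BbD => //; exact: Bb_cst.
  by move=> x; have := fa x; rewrite /b ltr_norml; lra.
move: h2; rewrite ba_integralD ?ba_integral_cst ?nu1.2//; last exact: Bb_cst.
lra.
Qed.

(** Hard half of the variational formula: on a partition whose entropy exceeds
    [r], the step function taking nearly optimal values [t i] on the cells does
    the job. *)
Lemma relative_entropy_gt mu nu (r : R) : ba1 nu -> ba1 mu ->
  (r%:E < relative_entropy nu mu)%E ->
  exists2 f, Bb T R f & r < 1 + ba_integral nu f - ba_integral mu (fun x => expR (f x)).
Proof.
move=> nu1 mu1 /ereal_sup_gt[_ [n [A [mA [cA tA nA] ->]]]].
have cov x : exists i, A i x by have : setT x by []; rewrite -cA => -[i _ Ax]; exists i.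
pose c x : 'I_n := projT1 (cid (cov x)).
have Ac x : A (c x) x := projT2 (cid (cov x)).
have cE i : c @^-1` [set i] = A i.
  apply/seteqP; split=> [x /= <-//|x Ax /=].
  by apply: tA => //; exists x.
have mc : mcolouring c by move=> i; rewrite cE.
rewrite /partition_entropy => /sum_entropy_term_gt[||| t ht].
- exact: index_enum_uniq.
- by move=> i; exact: nu1.1.
- by move=> i; exact: mu1.1.
exists (fun x => t (c x)); first exact: mcolouring_comp.
rewrite ba_integral_colouring// (ba_integral_colouring _ _ (fun i => expR (t i)))//.
rewrite -nu1.2 -(ba_sum_colouring nu _ mc) -big_split/= -sumrB (lt_le_trans ht)//.
by apply: ler_sum => i _; rewrite cE; lra.
Qed.

End entropy_duality.

(** * The worst-case functional and the payoffs *)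

Section worst_case.
Context {d : measure_display} {T : measurableType d} {R : realType}.
Context (Q : set (probability T R)) (xi : probability T R -> R).
Context (Q_neq0 : Q !=set0).
Context (xi_bounded : exists M : R, forall q, Q q -> `|xi q| <= M).
Implicit Types (f g h : T -> R) (mu nu : ba T R).

Definition worst_case h : R := inf [set \int[q]_x h x - xi q | q in Q].

Lemma worst_case_has_inf h : Bb T R h -> has_inf [set \int[q]_x h x - xi q | q in Q].
Proof.
move=> bh; have [M xiM] := xi_bounded; have [N hN] := bh.2.
split; first by have [q Qq] := Q_neq0; exists (\int[q]_x h x - xi q), q.
exists (- N - M) => _ [q Qq <-].
have := ba_integral_norm_le _ _ _ (ba1_probability q) bh hN.
have := xiM q Qq; rewrite ba_integral_probability// !ler_norml; lra.
Qed.

Lemma worst_case_le h q : Bb T R h -> Q q -> worst_case h <= \int[q]_x h x - xi q.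
Proof.
by move=> bh Qq; apply: ge_inf; [exact: (worst_case_has_inf _ bh).2|exists q].
Qed.

Lemma worst_case_ge h (k : R) : Bb T R h -> (forall q, Q q -> k <= \int[q]_x h x - xi q) ->
  k <= worst_case h.
Proof.
move=> bh kh; apply: lb_le_inf; first exact: (worst_case_has_inf _ bh).1.
by move=> _ [q Qq <-]; exact: kh.
Qed.

(** The real infimum agrees with the extended one because [h] and [xi] are
    bounded. *)
Lemma worst_caseE h : Bb T R h ->
  (ereal_inf [set 'E_q[h] - (xi q)%:E | q in Q] = (worst_case h)%:E)%E.
Proof.
move=> bh; have [h0 hlb] := worst_case_has_inf _ bh; rewrite -ereal_inf_EFin//.
congr ereal_inf; rewrite image_comp; apply: eq_imagel => q _ /=.
by rewrite expectation_ba// ba_integral_probability.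
Qed.

Lemma worst_case_concave (t : R) f g : 0 <= t <= 1 -> Bb T R f -> Bb T R g ->
  t * worst_case f + (1 - t) * worst_case g <= worst_case (fun x => t * f x + (1 - t) * g x).
Proof.
move=> /andP[t0 t1] bf bg.
apply: worst_case_ge => [|q Qq]; first exact: Bb_comb.
have := worst_case_le _ _ bf Qq; have := worst_case_le _ _ bg Qq.
rewrite -!ba_integral_probability//; last exact: Bb_comb.
by rewrite ba_integral_combr//; nra.
Qed.

Lemma worst_caseB f (k : R) : Bb T R f -> worst_case f - k <= worst_case (fun x => f x - k).
Proof.
move=> bf; have bk : Bb T R (fun x => f x - k) by apply: BbB => //; exact: Bb_cst.
apply: worst_case_ge => // q Qq; have := worst_case_le _ _ bf Qq.
rewrite -!ba_integral_probability// ba_integralB//; last exact: Bb_cst.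
by rewrite ba_integral_cst (ba1_probability q).2; lra.
Qed.

Let coQ := closed_convex_hull (@ba_of_probability d T R @` Q).

(** On the closed convex hull the biconjugate is finite:
    [worst_case h - M <= \int h dnu] holds at the points of [Q], where [M] bounds
    [|xi|], and is preserved by weak-* closed convex hulls. *)
Lemma biconjugate_fin nu : coQ nu -> exists b : R, [/\ concave_biconjugate Q xi nu = b%:E,
  forall h, Bb T R h -> b <= ba_integral nu h - worst_case h &
  forall k, (forall h, Bb T R h -> k <= ba_integral nu h - worst_case h) -> k <= b].
Proof.
move=> nuQ; have [M xiM] := xi_bounded.
pose A := [set ba_integral nu h - worst_case h | h in Bb T R].
have A0 : A !=set0.
  by exists (ba_integral nu (fun=> 0) - worst_case (fun=> 0)), (fun=> 0) => //; exact: Bb_cst.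
have Alb : has_lbound A.
  exists (- M) => _ [h bh <-].
  suff : worst_case h - M <= ba_integral nu h by lra.
  apply: (closed_convex_hull_integral_ge Q) => // q Qq.
  have := worst_case_le _ _ bh Qq; have := xiM q Qq; rewrite ler_norml; lra.
exists (inf A); split.
- rewrite -ereal_inf_EFin// image_comp /concave_biconjugate; congr ereal_inf.
  by apply: eq_imagel => h bh /=; rewrite worst_caseE.
- by move=> h bh; apply: ge_inf => //; exists h.
- by move=> k kA; apply: lb_le_inf => // _ [h bh <-]; exact: kA.
Qed.

Definition payoff_index := {fh : (T -> R) * (T -> R) | Bb T R fh.1 /\ Bb T R fh.2}.

Definition payoff (i : payoff_index) (k : ba T R * ba T R) : R :=
  1 + ba_integral k.1 (sval i).1 - ba_integral k.2 (fun x => expR ((sval i).1 x))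
  - (ba_integral k.1 (sval i).2 - worst_case (sval i).2).

Definition objective nu mu : \bar R := (relative_entropy nu mu - concave_biconjugate Q xi nu)%E.

(** Linearization of the objective: it is the supremum of the payoffs. *)
Lemma objective_leP nu mu (c : R) : coQ nu -> ba1 mu ->
  (objective nu mu <= c%:E)%E <-> forall i, payoff i (nu, mu) <= c.
Proof.
move=> nuQ mu1; have nu1 := closed_convex_hull_ba1 Q nu nuQ.
have [b [bE b_le b_ge]] := biconjugate_fin _ nuQ.
rewrite /objective bE leeBlDr// -EFinD; split=> [Hc [[f h] [/= bf bh]]|Hc].
  have := le_trans (ba_integral_le_relative_entropy mu nu f nu1 mu1 bf) Hc.
  by rewrite lee_fin /payoff/=; have := b_le h bh; lra.
rewrite leNgt; apply/negP => /relative_entropy_gt[//|//|f bf].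
apply/negP; rewrite -leNgt.
rewrite -lerBlDl; apply: b_ge => h bh.
by have := Hc (exist _ (f, h) (conj bf bh)); rewrite /payoff/=; lra.
Qed.

End worst_case.

(** * Duality *)

(** Both values of the exponential lie above its tangent at the mixed point. *)
Lemma expR_convex {R : realType} (t u v : R) : 0 <= t <= 1 ->
  expR (t * u + (1 - t) * v) <= t * expR u + (1 - t) * expR v.
Proof.
move=> /andP[t0 t1]; set w := t * u + (1 - t) * v.
have tangent z : expR w * (1 + (z - w)) <= expR z.
  have -> : expR z = expR w * expR (z - w) by rewrite -expRD addrC subrK.
  by rewrite ler_wpM2l ?expR_ge0// expR_ge1Dx.
have -> : expR w = t * (expR w * (1 + (u - w))) + (1 - t) * (expR w * (1 + (v - w))).
  by rewrite /w; ring.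
by rewrite lerD// ler_wpM2l ?tangent// subr_ge0.
Qed.

Section logarithmic_expectation.
Context {d : measure_display} {T : measurableType d} {R : realType}.
Implicit Types (q : probability T R).

Lemma measurable_lne_comp (X : T -> \bar R) : measurable_fun setT X ->
  (forall x, X x < +oo)%E -> measurable_fun setT (fun x => lne (X x)).
Proof.
move=> mX Xoo.
have -> : (fun x => lne (X x)) =
    (fun x => if (X x <= 0)%E then -oo%E else (ln (fine (X x)))%:E).
  by apply/funext => x; case: (X x) (Xoo x) => [r _|//|_]; rewrite ?lee_fin// leNye.
apply: measurable_fun_ifT => //.
  by apply: measurable_fun_lee => //; exact: measurable_cst.
apply/measurable_EFinP; apply: measurableT_comp; first exact: measurable_ln.
by apply: measurableT_comp => //; exact: fine_measurable.
Qed.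

(** Positive and negative parts are compared separately, so an infinite negative
    part of the logarithm causes no trouble. *)
Lemma expectation_log_le q (X : T -> \bar R) f : measurable_fun setT X -> Bb T R f ->
  (forall x, lne (X x) <= (f x)%:E)%E -> (forall x, X x < +oo)%E ->
  (expectation_log q X <= 'E_q[f])%E.
Proof.
move=> mX [mf _] Xf Xoo; rewrite /expectation_log.
have mL := measurable_lne_comp _ mX Xoo.
have mf' : measurable_fun setT (EFin \o f) by exact/measurable_EFinP.
case: ifPn => _; last exact: leNye.
rewrite expectation.unlock [leRHS]integralE; apply: leeB.
  apply: ge0_le_integral => //; [exact: measurable_funepos|exact: measurable_funepos|].
  by move=> x _; apply: (@funepos_le _ _ setT); rewrite ?inE.
apply: ge0_le_integral => //; [exact: measurable_funeneg|exact: measurable_funeneg|].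
by move=> x _; apply: (@funeneg_le _ _ setT); rewrite ?inE.
Qed.

Lemma expectation_log_expR q f : Bb T R f ->
  expectation_log q (fun x => (expR (f x))%:E) = 'E_q[f]%E.
Proof.
move=> bf; rewrite /expectation_log.
have -> : (fun x => lne (expR (f x))%:E) = EFin \o f.
  by apply/funext => x; rewrite lne_EFin ?expR_gt0//= expRK.
rewrite integral_funeneg_lt_pinfty//; last exact: Bb_integrable.
by rewrite expectation.unlock [RHS]integralE.
Qed.

End logarithmic_expectation.

Section duality.
Context {d : measure_display} {T : measurableType d} {R : realType}.
Context (P Q : set (probability T R)) (xi : probability T R -> R).
Context (P_neq0 : P !=set0).
Context (Q_neq0 : Q !=set0).
Context (xi_bounded : exists M : R, forall q, Q q -> `|xi q| <= M).

Let coP := closed_convex_hull (@ba_of_probability d T R @` P).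
Let coQ := closed_convex_hull (@ba_of_probability d T R @` Q).
Let J := objective Q xi.
Let pay := payoff Q xi.

(** The left-hand side of the duality formula. *)
Definition game_value : \bar R :=
  ereal_sup [set ereal_inf [set expectation_log q X - (xi q)%:E | q in Q]
            | X in bounded_evariable P]%E.

(** The function [f = ln (X + e)] is bounded, dominates [ln X] and has
    [\int e^f dmu <= 1 + e]; hence the payoff of [(f, f)] is at least
    [worst_case f - e]. *)
Lemma weak_duality nu mu : coQ nu -> coP mu -> (game_value <= J nu mu)%E.
Proof.
move=> nuQ muP; have mu1 := closed_convex_hull_ba1 P mu muP.
apply: ge_ereal_sup => _ [X [[mX X0 X1] [M XM]] <-].
apply: lee_real_bounds => c /ltW /(objective_leP _ _ Q_neq0 xi_bounded nu mu c nuQ mu1) Hc.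
apply/lee_addgt0Pr => e e0.
have Xfin x : X x = (fine (X x))%:E.
  by rewrite fineK// ge0_fin_numE// (le_lt_trans (XM x))// ltry.
have x0 x : 0 <= fine (X x) by exact: fine_ge0.
have xM x : fine (X x) <= M by rewrite -lee_fin -Xfin.
have bX : Bb T R (fun x => fine (X x)).
  split; last by exists M => x; rewrite ger0_norm.
  by apply: measurableT_comp => //; exact: fine_measurable.
pose f x := ln (fine (X x) + e).
have xe x : 0 < fine (X x) + e by rewrite ltr_wpDl.
have bf : Bb T R f.
  split; first by apply: measurableT_comp; [exact: measurable_ln|exact: measurable_funD bX.1 _].
  exists (`|ln e| + `|ln (M + e)|) => x.
  have Me : 0 < M + e by rewrite (lt_le_trans (xe x))// lerD2r.
  have l1 : ln e <= f x by rewrite ler_ln ?posrE// lerDr.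
  have l2 : f x <= ln (M + e) by rewrite ler_ln ?posrE// lerD2r.
  have := ler_norm (ln (M + e)); have := ler_norm (- ln e); rewrite normrN.
  have := normr_ge0 (ln e); have := normr_ge0 (ln (M + e)).
  by rewrite ler_norml => *; apply/andP; split; lra.
have ef : (fun x => expR (f x)) = (fun x => fine (X x) + e).
  by apply/funext => x; rewrite /f lnK// posrE.
have muf : ba_integral mu (fun x => expR (f x)) <= 1 + e.
  apply: (closed_convex_hull_integral_le P) muP; first exact: Bb_expR.
  move=> p Pp; rewrite ef -ba_integral_probability; last by apply: BbD => //; exact: Bb_cst.
  rewrite ba_integralD//; last exact: Bb_cst.
  rewrite ba_integral_cst (ba1_probability p).2 mulr1 lerD2r -lee_fin -expectation_ba//.
  by rewrite expectation.unlock; under eq_integral do rewrite -Xfin; exact: X1.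
have := Hc (exist _ (f, f) (conj bf bf)); rewrite /payoff/= => Hc'.
apply: (@le_trans _ _ (worst_case Q xi f)%:E).
  rewrite -worst_caseE//; apply/ereal_infP => _ [q Qq <-]; apply: ge_ereal_inf.
  exists (expectation_log q X - (xi q)%:E)%E; first by exists q.
  apply: leeB => //; apply: expectation_log_le => // x.
    rewrite /f; move: (Xfin x) (x0 x); case: (X x) => [r _ /= | |]//.
    rewrite le_eqVlt => /orP[/eqP <-|r0]; first by rewrite /= lexx leNye.
    by rewrite -/(lne r%:E) lne_EFin// lee_fin ler_ln ?posrE ?addr_gt0// lerDl ltW.
  by rewrite Xfin ltry.
by rewrite -EFinD lee_fin; lra.
Qed.

Lemma payoff_affine i : affine_on
  (convex_hull (@ba_of_probability d T R @` Q) `*` convex_hull (@ba_of_probability d T R @` P)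
    : set (ba T R * ba T R)%type) (pay i).
Proof.
move: i => [[f h] [/= bf bh]] t [nu mu] [nu' mu'] t01 _ _; rewrite /pay/payoff/=.
by rewrite !ba_integral_comb//; [ring|exact: Bb_expR].
Qed.

Lemma payoff_concave i j t : 0 <= t <= 1 -> exists k, forall nm,
  ba1 nm.2 -> t * pay i nm + (1 - t) * pay j nm <= pay k nm.
Proof.
move: i j => [[f h] [/= bf bh]] [[f' h'] [/= bf' bh']] t01.
exists (exist _ (_, _) (conj (Bb_comb t _ _ bf bf') (Bb_comb t _ _ bh bh'))) => -[nu mu] /= mu1.
rewrite /pay/payoff/= !ba_integral_combr//.
have := worst_case_concave _ _ Q_neq0 xi_bounded t _ _ t01 bh bh'.
have : ba_integral mu (fun x => expR (t * f x + (1 - t) * f' x)) <=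
    t * ba_integral mu (fun x => expR (f x)) + (1 - t) * ba_integral mu (fun x => expR (f' x)).
  rewrite -ba_integral_combr; [|exact: Bb_expR..].
  apply: ba_integral_le => //; [exact/Bb_expR/Bb_comb|apply: Bb_comb; exact: Bb_expR|].
  by move=> x; exact: expR_convex.
lra.
Qed.

(** The function [f] is turned into the e-variable [e^f / S] with
    [S = sup_P E_P e^f]; passing from [1 - S] to [- ln S] only raises its
    value. *)
Lemma payoff_le_value i (c : R) :
  (forall nm, (convex_hull (@ba_of_probability d T R @` Q) `*`
     convex_hull (@ba_of_probability d T R @` P)) nm -> c <= pay i nm) -> (c%:E <= game_value)%E.
Proof.
move: i => [[f h] [/= bf bh]] Hc.
have be := Bb_expR _ bf.
pose A := [set \int[p]_x expR (f x) | p in P].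
have A0 : A !=set0 by have [p Pp] := P_neq0; exists (\int[p]_x expR (f x)), p.
have Aub : has_ubound A.
  have [N fN] := be.2; exists N => _ [p Pp <-].
  have := ba_integral_norm_le _ _ _ (ba1_probability p) be fN.
  by rewrite ba_integral_probability// ler_norml => /andP[].
pose S := sup A.
have AS p : P p -> \int[p]_x expR (f x) <= S by move=> Pp; apply: ub_le_sup => //; exists p.
have S0 : 0 < S.
  have [p Pp] := P_neq0; apply: lt_le_trans (AS p Pp).
  have [N fN] := bf.2; apply: (@lt_le_trans _ _ (expR (- N))); first exact: expR_gt0.
  have := ba_integral_le _ _ _ (ba1_probability p) (Bb_cst (expR (- N))) be.
  rewrite ba_integral_cst (ba1_probability p).2 mulr1 ba_integral_probability//; apply => x.
  by rewrite ler_expR; have := fN x; rewrite ler_norml => /andP[].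
have cS : c <= worst_case Q xi f + 1 - S.
  suff : c - 1 + S <= worst_case Q xi f by lra.
  apply: worst_case_ge => // q Qq.
  suff : S <= \int[q]_x f x - xi q + 1 - c by lra.
  apply: ge_sup => // _ [p Pp <-].
  have := Hc (ba_of_probability q, ba_of_probability p).
  rewrite /pay/payoff/= !ba_integral_probability// => /(_ _)/=.
  have := worst_case_le _ _ Q_neq0 xi_bounded _ _ bh Qq.
  move=> H1 H2; have Qhq := sub_convex_hull _ _ (imageP (@ba_of_probability d T R) Qq).
  have Php := sub_convex_hull _ _ (imageP (@ba_of_probability d T R) Pp).
  have := H2 (conj Qhq Php); lra.
have bg : Bb T R (fun x => f x - ln S) by apply: BbB => //; exact: Bb_cst.
have lnS : ln S <= S - 1.
  have := @le_ln1Dx R (S - 1); rewrite (_ : 1 + (S - 1) = S); last by ring.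
  by apply; lra.
apply: le_trans (_ : (worst_case Q xi (fun x => f x - ln S))%:E <= _)%E.
  by rewrite lee_fin; have := worst_caseB _ _ Q_neq0 xi_bounded f (ln S) bf; lra.
apply: ereal_sup_ubound; exists (fun x => (expR (f x - ln S))%:E); last first.
  rewrite -worst_caseE//; congr ereal_inf; apply: eq_imagel => q Qq.
  by rewrite expectation_log_expR.
have bG := Bb_expR _ bg.
split; last first.
  have [N HN] := bG.2; exists N => x; rewrite lee_fin.
  by rewrite (le_trans (ler_norm _)).
split; [exact/measurable_EFinP/bG.1|by move=> x; rewrite lee_fin expR_ge0|].
move=> p Pp; have := expectation_ba p _ bG; rewrite expectation.unlock => ->.
have -> : (fun x => expR (f x - ln S)) = (fun x => S^-1 * expR (f x) + 0).
  by apply/funext => x; rewrite expRD expRN lnK ?posrE// addr0 mulrC.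
rewrite ba_integral_lin//; last exact: Bb_cst.
rewrite ba_integral_cst mul0r addr0 lee_fin mulrC ler_pdivrMr// mul1r.
by rewrite ba_integral_probability// AS.
Qed.

Lemma payoff_continuous i : continuous (pay i : (ba T R * ba T R)%type -> R).
Proof.
move: i => [[f h] [/= bf bh]] nm; rewrite /pay/payoff/=.
have c1 g : Bb T R g -> {for nm, continuous (fun k : ba T R * ba T R => ba_integral k.1 g)}.
  move=> bg; apply: (@continuous_comp _ _ _ fst (fun m : ba T R => ba_integral m g)).
    exact: cvg_fst.
  exact: ba_integral_continuous.
have c2 g : Bb T R g -> {for nm, continuous (fun k : ba T R * ba T R => ba_integral k.2 g)}.
  move=> bg; apply: (@continuous_comp _ _ _ snd (fun m : ba T R => ba_integral m g)).
    exact: cvg_snd.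
  exact: ba_integral_continuous.
apply: cvgB; last by apply: cvgB; [exact: c1|exact: cvg_cst].
apply: cvgB; last by apply: c2; exact: Bb_expR.
by apply: cvgD; [exact: cvg_cst|exact: c1].
Qed.

Lemma closed_payoff_le i (c : R) : closed [set k : ba T R * ba T R | pay i k <= c].
Proof.
rewrite (_ : mkset _ = pay i @^-1` [set y | y <= c])//.
by apply: closed_comp; [move=> mu _; exact: payoff_continuous|exact: closed_le].
Qed.

(** Compactness reduces the claim to finitely many indices.  For those, the
    failure of the claim feeds [finite_minimax] and contradicts
    [payoff_le_value]. *)
Lemma minimax_point (c : R) : (game_value < c%:E)%E ->
  exists2 k, (coQ `*` coP) k & forall i, pay i k <= c.
Proof.
move=> vc.
apply: compact_fip => [|i|s].
- by apply: compact_setX; exact: closed_convex_hull_compact.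
- exact: closed_payoff_le.
pose K := (convex_hull (@ba_of_probability d T R @` Q) `*`
     convex_hull (@ba_of_probability d T R @` P)) : set (ba T R * ba T R)%type.
apply: contrapT => nk.
have [i Hi] : exists i, forall k, K k -> c <= pay i k.
  apply: (@finite_minimax R (ba T R * ba T R)%type _ pay c s K).
  - by constructor; exists (fun=> 0, fun=> 0); split; exact: Bb_cst.
  - move=> t [nu mu] [nu' mu'] t01 [/= nuQ muP] [/= nuQ' muP'].
    by split; apply: convex_hull_convex.
  - exact: payoff_affine.
  - move=> i j t t01; have [k Hk] := payoff_concave i j t t01; exists k => nm [_ muP].
    by apply: Hk; apply: (closed_convex_hull_ba1 P); exact: convex_hull_closed_convex_hull.
  - move=> k [nuQ muP]; apply: contrapT => ns; apply: nk; exists k.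
      by split; exact: convex_hull_closed_convex_hull.
    move=> i si; rewrite leNgt; apply/negP => /ltW cp; apply: ns; by exists i.
by have := payoff_le_value i c Hi; rewrite leNgt vc.
Qed.

End duality.

Section attainment_of_minima.
Context {d : measure_display} {T : measurableType d} {R : realType}.
Context (P Q : set (probability T R)) (xi : probability T R -> R).
Context (P_neq0 : P !=set0) (Q_neq0 : Q !=set0).
Context (xi_bounded : exists M : R, forall q, Q q -> `|xi q| <= M).

Let coP := closed_convex_hull (@ba_of_probability d T R @` P).
Let coQ := closed_convex_hull (@ba_of_probability d T R @` Q).
Let J := objective Q xi.

Lemma closed_convex_hull_neq0 (A : set (probability T R)) : A !=set0 ->
  closed_convex_hull (@ba_of_probability d T R @` A) !=set0.
Proof.
move=> [p Ap]; exists (ba_of_probability p).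
by apply: convex_hull_closed_convex_hull; apply: sub_convex_hull; exists p.
Qed.

Lemma objective_attains_min nu : coQ nu -> attains_min coP (J nu).
Proof.
move=> nuQ; apply: (@attains_min_compact _ _ _ _
  (fun c => \bigcap_i [set mu | payoff Q xi i (nu, mu) <= c])).
- exact: closed_convex_hull_compact.
- exact: closed_convex_hull_neq0.
- move=> c; apply: closed_bigI => -[[f h] [/= bf bh]] _.
  pose k := 1 + ba_integral nu f - (ba_integral nu h - worst_case Q xi h) - c.
  rewrite (_ : mkset _ = [set mu | k <= ba_integral mu (fun x => expR (f x))]).
    by apply: closed_ba_integral_ge; exact: Bb_expR.
  by apply/seteqP; split=> mu; rewrite /k /payoff/=; lra.
- move=> c mu muP; have mu1 := closed_convex_hull_ba1 P mu muP.
  rewrite (objective_leP Q xi Q_neq0 xi_bounded nu mu c nuQ mu1).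
  by split=> [H i _|H i]; exact: H.
Qed.

Lemma objective_attains_joint_min :
  attains_min (coQ `*` coP) (fun k : ba T R * ba T R => J k.1 k.2).
Proof.
apply: (@attains_min_compact _ _ _ _
  (fun c => \bigcap_i [set k | payoff Q xi i k <= c])).
- by apply: compact_setX; exact: closed_convex_hull_compact.
- have [nu nuQ] := closed_convex_hull_neq0 _ Q_neq0.
  by have [mu muP] := closed_convex_hull_neq0 _ P_neq0; exists (nu, mu).
- by move=> c; apply: closed_bigI => i _; exact: closed_payoff_le.
- move=> c [nu mu] [/= nuQ muP]; have mu1 := closed_convex_hull_ba1 P mu muP.
  rewrite (objective_leP Q xi Q_neq0 xi_bounded nu mu c nuQ mu1).
  by split=> [H i _|H i]; exact: H.
Qed.

End attainment_of_minima.

Local Open Scope ereal_scope.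

Theorem theorem3p4 (R : realType) (d : measure_display) (T : measurableType d)
    (P Q : set (probability T R)) (xi : probability T R -> R)
    (P_neq0 : P !=set0) (Q_neq0 : Q !=set0)
    (xi_bounded : exists M : R, forall q, Q q -> (`|xi q| <= M)%R) :
  let coP := closed_convex_hull (@ba_of_probability d T R @` P) in
  let coQ := closed_convex_hull (@ba_of_probability d T R @` Q) in
  let J (nu mu : ba T R) :=
    relative_entropy nu mu - concave_biconjugate Q xi nu in
  let minP nu := ereal_inf [set J nu mu | mu in coP] in
  let minQP := ereal_inf [set minP nu | nu in coQ] in
  [/\ ereal_sup [set ereal_inf [set expectation_log q X - (xi q)%:E | q in Q]
                | X in bounded_evariable P] = minQP,
      forall nu, coQ nu -> attains_min coP (J nu),
      attains_min coQ minP
    & exists mu nu, [/\ coP mu, coQ nu & J nu mu = minQP]].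
Proof.
move=> coP coQ J minP minQP.
have minPJ nu mu : coP mu -> minP nu <= J nu mu.
  by move=> muP; apply: ereal_inf_lbound; exists mu.
have minQP_le nu : coQ nu -> minQP <= minP nu.
  by move=> nuQ; apply: ereal_inf_lbound; exists nu.
have [[nu mu] [nuQ muP] Jmin] := objective_attains_joint_min P Q xi P_neq0 Q_neq0 xi_bounded.
have Jstar : J nu mu = minQP.
  apply/eqP; rewrite eq_le; apply/andP; split; last first.
    exact: le_trans (minQP_le nu nuQ) (minPJ nu mu muP).
  apply/ereal_infP => _ [nu' nuQ' <-]; apply/ereal_infP => _ [mu' muP' <-].
  rewrite -[J nu mu]/(objective Q xi (nu, mu).1 (nu, mu).2) Jmin.
  by apply: ereal_inf_lbound; exists (nu', mu').
split.
- apply/eqP; rewrite eq_le; apply/andP; split.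
    rewrite -Jstar; exact: (weak_duality P Q xi Q_neq0 xi_bounded nu mu nuQ muP).
  apply: lee_real_bounds => c vc.
  have [[nu' mu'] [/= nuQ' muP'] Hk] := minimax_point P Q xi P_neq0 Q_neq0 xi_bounded c vc.
  apply: le_trans (minQP_le nu' nuQ') (le_trans (minPJ nu' mu' muP') _).
  apply/(objective_leP Q xi Q_neq0 xi_bounded nu' mu' c nuQ') => //.
  exact: (closed_convex_hull_ba1 P).
- by move=> nu' nuQ'; exact: (objective_attains_min P Q xi P_neq0 Q_neq0 xi_bounded).
- exists nu => //; apply/eqP; rewrite eq_le minQP_le// andbT.
  by rewrite -/minQP -Jstar minPJ.
- by exists mu, nu.
Qed.
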